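(* Let $n\ge1$, $\alpha_1,\dots,\alpha_{n+1}>0$, $\nu_1,\dots,\nu_n\in\mathbb{C}$, $\lambda\in\mathbb{R}$, and assume that $\alpha_{n+1}i+a_j\notin\{0,-1,-2,\dots\}$ for all integers $i\ge1$ and all $j=1,\dots,n$. Then for every $s\in\mathbb{C}$ with $\operatorname{Re}s>0$, $$\int_0^\infty e^{-sx}\,\mathcal{W}^{(\bar\alpha,\bar\nu)}(\lambda x^{\alpha_{n+1}})\,dx=\frac1s\sum_{k=0}^\infty\left(\prod_{i=1}^k\prod_{j=1}^n\frac{\Gamma(\alpha_{n+1}i+a_j)}{\Gamma(\alpha_{n+1}i+b_j)}\right)\frac{\Gamma(\alpha_{n+1}k+1)}{\Gamma(\alpha_{n+1}k+b_{n+1})}\left(\frac{\lambda}{s^{\alpha_{n+1}}}\right)^k,$$ where $s^{\alpha_{n+1}}$ denotes the principal branch.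
   Context: For parameters $\alpha_1,\dots,\alpha_{n+1}>0$, $\nu_1,\dots,\nu_n\in\mathbb{C}$, with the conventions $\alpha_0=\nu_0=0$, put for $j=1,\dots,n+1$ $$a_j=1+\sum_{m=1}^{j}(\nu_{m-1}-\alpha_m),\qquad b_j=1+\sum_{m=1}^{j}(\nu_{m-1}-\alpha_{m-1}),$$ so that $a_j=b_j-\alpha_j$. The multi-index special function is $$\mathcal{W}^{(\bar\alpha,\bar\nu)}(z)=\sum_{k=0}^\infty\left(\prod_{i=1}^k\prod_{j=1}^n\frac{\Gamma(\alpha_{n+1}i+a_j)}{\Gamma(\alpha_{n+1}i+b_j)}\right)\frac{z^k}{\Gamma(\alpha_{n+1}k+b_{n+1})},\qquad z\in\mathbb{C}.$$ Here $1/\Gamma$ is the entire reciprocal gamma function (equal to $0$ at the poles of $\Gamma$), and empty products equal $1$. *)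

(* Defs.v *)
From HB Require Import structures.
From mathcomp Require Import all_boot all_order all_algebra.
From mathcomp Require Export complex.
From mathcomp Require Export all_classical all_reals all_analysis.
Set Implicit Arguments.
Unset Strict Implicit.
Unset Printing Implicit Defensive.
Import Order.TTheory GRing.Theory Num.Theory numFieldNormedType.Exports.
Local Open Scope classical_set_scope.
Local Open Scope complex_scope.
Local Open Scope ring_scope.

Section ComplexAnalysis.
Variable R : realType.
Implicit Types (z w : R[i]) (D : set R) (f : R -> R[i]) (u : nat -> R[i]).

Definition cexp z : R[i] :=
  (expR (complex.Re z))%:C
  * (cos (complex.Im z) +i* sin (complex.Im z)).

(* The principal argument, in ]-pi, pi]; its value at 0 is never used. *)
Definition carg z : R :=
  let t := acos (complex.Re z / ComplexField.Normc.normc z) in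
  if 0 <= complex.Im z then t else - t.

Definition clog z : R[i] := ln (ComplexField.Normc.normc z) +i* carg z.

Definition cpow z w : R[i] :=
  if z == 0 then (w == 0)%:R else cexp (w * clog z).

(* Complex-valued Lebesgue integrals are taken componentwise. *)
Definition cintegrable D f : Prop :=
  (@lebesgue_measure R).-integrable D (EFin \o (fun x => complex.Re (f x)))
  /\ (@lebesgue_measure R).-integrable D (EFin \o (fun x => complex.Im (f x))).

Definition cintegral D f : R[i] :=
  (\int[@lebesgue_measure R]_(x in D) complex.Re (f x))
  +i* (\int[@lebesgue_measure R]_(x in D) complex.Im (f x)).

(* The topology of R[i] is that of its norm, which the library provides on the
   alias R[i]^o. *)
Definition csummable u : Prop := cvgn (series (u : nat -> R[i]^o)).

Definition csum u : R[i] := limn (series (u : nat -> R[i]^o)).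

Definition Gamma_pole z : Prop := exists k : nat, z = - k%:R.

Definition Gamma_integral z : R[i] :=
  cintegral `]0, +oo[ (fun t => cpow t%:C (z - 1) * (expR (- t))%:C).

(* Euler's integral for 0 < Re z, continued to the left through
   Gamma (z + m) = z (z + 1) ... (z + m - 1) Gamma z, where m is the least
   natural number with 0 < Re z + m (m = 0 when 0 < Re z).  The value at a pole
   is the junk value 0. *)
Definition Gamma z : R[i] :=
  let m := Num.truncn (1 - complex.Re z) in
  Gamma_integral (z + m%:R) / \prod_(i < m) (z + i%:R).

(* The entire function 1 / Gamma. *)
Definition rGamma z : R[i] :=
  if `[< Gamma_pole z >] then 0 else (Gamma z)^-1.

End ComplexAnalysis.

(* Turns a tuple (v_1, ..., v_n), stored as v : 'I_n -> V, into a function of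
   the index 1, ..., n, with v_0 = 0. *)
Definition index1 (V : nmodType) (n : nat) (v : 'I_n -> V) (m : nat) : V :=
  if m is k.+1 then oapp v 0 (insub k) else 0.

Section MultiIndexW.
Variables (R : realType) (n : nat).
Variables (alpha : 'I_n.+1 -> R) (nu : 'I_n -> R[i]).

Definition Wa (j : nat) : R[i] :=
  1 + \sum_(1 <= m < j.+1) (index1 nu m.-1 - (index1 alpha m)%:C).

Definition Wb (j : nat) : R[i] :=
  1 + \sum_(1 <= m < j.+1) (index1 nu m.-1 - (index1 alpha m.-1)%:C).

(* alpha_{n+1} *)
Definition alast : R := alpha ord_max.

Definition Wprod (k : nat) : R[i] :=
  \prod_(1 <= i < k.+1) \prod_(1 <= j < n.+1)
    (Gamma (alast%:C * i%:R + Wa j) * rGamma (alast%:C * i%:R + Wb j)).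

Definition Wterm (z : R[i]) (k : nat) : R[i] :=
  Wprod k * (z ^+ k * rGamma (alast%:C * k%:R + Wb n.+1)).

Definition W (z : R[i]) : R[i] := csum (Wterm z).

End MultiIndexW.

(* Main.v *)
Require Import Defs.
From HB Require Import structures.
From mathcomp Require Import all_boot all_order all_algebra.
From mathcomp Require Import measurable_realfun ring lra.
Import Order.TTheory GRing.Theory Num.Theory numFieldNormedType.Exports.
Local Open Scope classical_set_scope.
Local Open Scope complex_scope.
Local Open Scope ring_scope.
Set Implicit Arguments.
Unset Strict Implicit.
Unset Printing Implicit Defensive.

(* Write s ^ (a + 1) with the principal branch and let
   L(a, s) = \int_0^oo x ^ a e ^ (- s x) dx.  Integration by parts gives
   s L(a + 1, s) = (a + 1) L(a, s), hence d/ds (s ^ (a + 1) L(a, s)) = 0, and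
   L(a, s) = Gamma (a + 1) / s ^ (a + 1) on the half-plane Re s > 0.  The theorem
   is the termwise application of this formula.

   To integrate termwise, one needs that the coefficients decay faster than any
   geometric sequence.  For z = a + 1 + iq the real part of a ^ (- iq) Gamma z is
   \int t ^ a e ^ (- t) cos (q ln (t / a)) dt, at least Gamma (a + 1) (1 - q ^ 2 / (2 a)).
   So |Gamma z| and Gamma (Re z) agree up to a constant factor far to the right on
   every horizontal line, which reduces Gamma z / Gamma (z + alpha_j) -> 0, and the
   polynomial growth of Gamma (x + 1) / Gamma (x + b), to the real Gamma
   function. *)

(** * Laplace integrals of powers *)

(** Since the nu_j are complex, Gamma is needed off the real axis. The triangle inequality bounds
    |Gamma| from above; the obstacle is the lower bound required by 1 / Gamma, because Euler's
    integrand oscillates. As alpha_{n+1} is real, alpha_{n+1} i + a_j and alpha_{n+1} i + b_j keep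
    one imaginary part q while their real parts grow. The weight t ^ a e ^ (- t) concentrates near t
    = a, where the phase q ln t hardly varies, so for fixed q the oscillation costs only a constant
    factor.

    Substituting t = s x for non-real s would rotate the ray of integration; an invariant along the
    segment from 1 to s avoids this.

    The index a stands for Gamma (a + 1): for a >= 0 all integrands are bounded at 0, and only a =
    alpha_{n+1} k occurs in the end.

    Integrating absolute values termwise produces Gamma (alpha_{n+1} k + 1) (Re s) ^ (- alpha_{n+1}
    k - 1). The coefficient bound is therefore proved with this Gamma factor included, and then
    serves the series of W, the dominating series and the right-hand side alike. *)

Section HalfLine.
Context {R : realType}.
Local Notation mu := (@lebesgue_measure R).
Implicit Types (a p q A B x y t : R) (f g F : R -> R).

Lemma integrable_expRN p : 0 < p ->
  mu.-integrable `[0, +oo[ (EFin \o (fun x => expR (- p * x))).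
Proof.
move=> p0.
have h : mu.-integrable `[0, +oo[ (EFin \o exponential_pdf p).
  by apply: (integrableS _ _ _ (integrable_exponential_pdf p0)).
apply: (@eq_integrable _ _ _ mu _ _ (fun x => p^-1%:E * (EFin \o exponential_pdf p) x)%E) => //.
  move=> x /set_mem/=; rewrite in_itv/= andbT => x0.
  by rewrite exponential_pdfE// -EFinM mulKf// gt_eqF.
by apply: integrableZl.
Qed.

Lemma integrableZ f p : mu.-integrable `[0, +oo[ (EFin \o f) ->
  mu.-integrable `[0, +oo[ (EFin \o (fun x => p * f x)).
Proof.
move=> If; rewrite (_ : _ \o _ = (fun x => p%:E * (EFin \o f) x)%E).
  exact: integrableZl.
by apply/funext => x; rewrite /= EFinM.
Qed.

Lemma integrableDR f g : mu.-integrable `[0, +oo[ (EFin \o f) ->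
  mu.-integrable `[0, +oo[ (EFin \o g) ->
  mu.-integrable `[0, +oo[ (EFin \o (fun x => f x + g x)).
Proof.
move=> If Ig; rewrite (_ : _ \o _ = (EFin \o f) \+ (EFin \o g))%E//.
exact: integrableD.
Qed.

Lemma powR_le_expR a p : 0 <= a -> 0 < p ->
  exists2 C, 0 < C & forall x, 0 <= x -> x `^ a <= C * expR (p * x).
Proof.
move=> a0 p0; have [->|an0] := eqVneq a 0.
  exists 1 => // x x0; rewrite powRr0 mul1r -[leLHS]expR0 ler_expR.
  exact: mulr_ge0 (ltW p0) x0.
have {an0 a0} a0 : 0 < a by rewrite lt_def an0.
(* From ln y < y at y = (p / a) x: a ln x < p x - a ln (p / a). *)
exists (expR (- (a * ln (p / a)))); first exact: expR_gt0.
move=> x; rewrite le_eqVlt => /predU1P[<-|x0].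
  by rewrite powR0 ?gt_eqF// mulr_ge0 ?expR_ge0.
rewrite -expRD /powR gt_eqF// ler_expR.
have pa : 0 < p / a by rewrite divr_gt0.
have /ltW : ln (p / a * x) < p / a * x by apply: ln_sublinear; rewrite mulr_gt0.
rewrite lnM ?posrE// -(ler_pM2l a0) mulrDr => h.
have -> : p * x = a * (p / a * x) by field; rewrite gt_eqF.
lra.
Qed.

(* The derivative of [trig A B] is [trig B (- A)], so that carrying the two
   coefficients along treats cosine and sine, that is real and imaginary parts,
   by the same lemmas. *)
Definition trig A B y := A * cos y + B * sin y.

Lemma normr_trig A B y : `|trig A B y| <= `|A| + `|B|.
Proof.
rewrite /trig (le_trans (ler_normD _ _))// !normrM lerD//.
  by rewrite ler_piMr// cos_max.
by rewrite ler_piMr// sin_max.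
Qed.

Lemma is_derive_trig A B y : is_derive y 1 (trig A B) (trig B (- A) y).
Proof.
by rewrite /trig; apply: is_derive_eq; rewrite /GRing.scale/=; ring.
Qed.

Lemma continuous_trig A B : continuous (trig A B).
Proof.
move=> y; apply: differentiable_continuous; apply/derivable1_diffP.
exact: (@ex_derive _ _ _ _ _ _ _ (is_derive_trig A B y)).
Qed.

Definition laplaceK a p q A B x := x `^ a * expR (- p * x) * trig A B (q * x).

(* \int_0^oo x ^ a e ^ (- s x) dx, with s = p + iq, has real part
   [laplaceI a p q 1 0] and imaginary part [- laplaceI a p q 0 1]. *)
Definition laplaceI a p q A B := \int[mu]_(x in `[0, +oo[) laplaceK a p q A B x.

Lemma measurable_trig A B q (D : set R) : measurable D ->
  measurable_fun D (fun x => trig A B (q * x)).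
Proof.
move=> mD; apply: measurable_funTS.
apply: (@measurableT_comp _ _ _ _ _ _ (trig A B) _ (fun x => q * x)).
  by apply: continuous_measurable_fun; exact: continuous_trig.
exact: measurable_funM.
Qed.

Lemma measurable_laplaceK a p q A B (D : set R) : measurable D ->
  measurable_fun D (laplaceK a p q A B).
Proof.
move=> mD; apply: measurable_funM; last exact: measurable_trig.
apply: measurable_funM; first exact: measurable_funTS.
by apply: measurable_funTS; apply: measurableT_comp => //; exact: measurable_funM.
Qed.

Lemma integrable_powR_expR a p : 0 <= a -> 0 < p ->
  mu.-integrable `[0, +oo[ (EFin \o (fun x => x `^ a * expR (- p * x))).
Proof.
(* Half of the exponential decay absorbs the power; the other half remains integrable. *)
move=> a0 p0; have p20 : 0 < p / 2 by rewrite divr_gt0.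
have [C C0 hC] := powR_le_expR a0 p20.
apply: (@le_integrable _ _ _ mu _ _ _ (EFin \o (fun x => C * expR (- (p / 2) * x)))) => //.
- apply/measurable_EFinP; apply: measurable_funM; first exact: measurable_funTS.
  by apply: measurable_funTS; apply: measurableT_comp => //; exact: measurable_funM.
- move=> x/=; rewrite in_itv/= andbT => x0; rewrite lee_fin.
  rewrite !ger0_norm ?mulr_ge0 ?powR_ge0 ?expR_ge0 ?(ltW C0)//.
  apply: (le_trans (ler_wpM2r (expR_ge0 _) (hC _ x0))).
  rewrite -[leLHS]mulrA -expRD ler_wpM2l ?(ltW C0)// ler_expR; lra.
- exact/integrableZ/integrable_expRN.
Qed.

Lemma normr_laplaceK a p q A B x :
  `|laplaceK a p q A B x| <= (`|A| + `|B|) * (x `^ a * expR (- p * x)).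
Proof.
have h : 0 <= x `^ a * expR (- p * x) by rewrite mulr_ge0 ?powR_ge0 ?expR_ge0.
rewrite /laplaceK normrM mulrC (ger0_norm h).
exact/(ler_wpM2r h)/normr_trig.
Qed.

Lemma integrable_laplaceK a p q A B : 0 <= a -> 0 < p ->
  mu.-integrable `[0, +oo[ (EFin \o laplaceK a p q A B).
Proof.
move=> a0 p0.
apply: (@le_integrable _ _ _ mu _ _ _
   (EFin \o (fun x => (`|A| + `|B|) * (x `^ a * expR (- p * x))))) => //.
- by apply/measurable_EFinP; exact: measurable_laplaceK.
- move=> x/= _; rewrite lee_fin [leRHS]ger0_norm ?normr_laplaceK//.
  by rewrite mulr_ge0 ?mulr_ge0 ?powR_ge0 ?expR_ge0// addr_ge0.
- exact/integrableZ/integrable_powR_expR.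
Qed.

(** Dominated convergence for the truncations of [f], with bound |f|. It carries the fundamental
    theorem of calculus from compact intervals to the half-line. *)
Lemma cvg_Rintegral_itv0n f : mu.-integrable `[0, +oo[ (EFin \o f) ->
  \int[mu]_(x in `[0, n%:R]) f x @[n --> \oo] --> \int[mu]_(x in `[0, +oo[) f x.
Proof.
move=> intf.
have mf := measurable_int _ intf.
have E n : \int[mu]_(x in `[0, n%:R]) f x =
           \int[mu]_(x in `[0, +oo[) (f \_ `[0, n%:R]) x.
  rewrite -Rintegral_mkcondr; congr Rintegral.
  by apply/esym/classical_sets.setIidPr => x /=; rewrite !in_itv/= => /andP[->].
rewrite (eq_cvg _ _ E).
apply: fine_cvg; rewrite fineK; last exact: integrable_fin_num.
have [] := @dominated_convergence _ _ _ mu _ (measurable_itv `[0, +oo[)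
  (fun n x => ((f \_ `[0, n%:R]) x)%:E) (EFin \o f) (fun x => `|(f x)%:E|%E).
- move=> n; apply/measurable_EFinP/measurable_restrict => //.
  apply: (@measurable_funS _ _ _ _ (`[0, +oo[ : set R)) => //.
  exact/measurable_EFinP.
- exact: mf.
- apply: aeW => x /=; rewrite in_itv/= andbT => x0.
  apply: cvg_EFin; first exact: nearW.
  apply: cvg_near_cst; near=> n; apply/eqP.
  rewrite /= patchE ifT//; apply: mem_set; rewrite /= in_itv/= x0.
  by near: n; exact: nbhs_infty_ger.
- exact: integrable_abse.
- apply: aeW => x n _; rewrite patchE; case: ifPn => _ //.
  by rewrite /= normr0 lee_fin.
- by move=> _ _.
Unshelve. all: by end_near. Qed.

End HalfLine.

(** * Integration by parts on the half-line *)

Section LaplaceParts.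
Context {R : realType}.
Local Notation mu := (@lebesgue_measure R).
Implicit Types (a p q A B x y t : R) (f g F : R -> R).

Lemma cvg_at_right_powR a : 0 <= a -> x `^ a @[x --> 0^'+] --> (0 : R) `^ a.
Proof.
rewrite le_eqVlt => /predU1P[<-|a0]; last by rewrite powR0 ?gt_eqF//; exact: powR_cvg0.
by under eq_fun do rewrite powRr0; rewrite powRr0; exact: cvg_cst.
Qed.

Lemma is_derive_laplaceK a p q A B x : 0 < x ->
  is_derive x 1 (laplaceK (a + 1) p q A B)
    ((a + 1) * laplaceK a p q A B x
     + (- p * laplaceK (a + 1) p q A B x + q * laplaceK (a + 1) p q B (- A) x)).
Proof.
move=> x0.
have Hp := is_derive1_powR (a + 1) x0.
have He : is_derive x 1 (fun x => expR (- p * x)) (- p * expR (- p * x)).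
  apply: is_derive_eq; rewrite /GRing.scale/=; ring.
have Hq : is_derive x 1 (fun x => q * x) q.
  apply: is_derive_eq; rewrite /GRing.scale/=; ring.
have Ht : is_derive x 1 (fun x => trig A B (q * x)) (q * trig B (- A) (q * x)).
  have Ht' := is_derive_trig A B (q * x).
  apply: (@is_derive_eq _ _ _ _ _ _ _ _ (is_derive1_comp Ht' Hq)).
  by rewrite mulrC.
rewrite (_ : laplaceK (a + 1) p q A B =
   (fun x => x `^ (a + 1)) * (fun x => expR (- p * x)) * (fun x => trig A B (q * x)));
  last by [].
apply: is_derive_eq; rewrite !fctE /laplaceK /GRing.scale/= addrK; ring.
Qed.

Lemma cvg_at_right_laplaceK a p q A B : 0 <= a ->
  laplaceK a p q A B x @[x --> 0^'+] --> laplaceK a p q A B 0.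
Proof.
move=> a0; apply: cvgM.
  apply: cvgM; first exact: cvg_at_right_powR.
  apply: cvg_at_right_filter; apply: continuous_comp; last exact: continuous_expR.
  by apply: cvgM; [exact: cvg_cst|exact: cvg_id].
apply: cvg_at_right_filter; apply: continuous_comp; last exact: continuous_trig.
by apply: cvgM; [exact: cvg_cst|exact: cvg_id].
Qed.

Lemma continuous_laplaceK a p q A B x : 0 < x ->
  {for x, continuous (laplaceK a p q A B)}.
Proof.
(* [is_derive_laplaceK] holds for every real exponent when x > 0, so it applies to a = (a - 1) +
   1. *)
move=> x0; rewrite -(subrK 1 a); apply: differentiable_continuous.
apply/derivable1_diffP.
exact: (@ex_derive _ _ _ _ _ _ _ (is_derive_laplaceK (a - 1) p q A B x0)).
Qed.

Lemma within_continuous_laplaceK a p q A B : 0 <= a ->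
  {within `[0, +oo[, continuous (laplaceK a p q A B)}.
Proof.
move=> a0; apply/continuous_within_itvcyP; split.
  by move=> x; rewrite in_itv/= andbT => x0; exact: continuous_laplaceK.
exact: cvg_at_right_laplaceK.
Qed.

Lemma cvgn_laplaceK a p q A B : 0 <= a -> 0 < p ->
  laplaceK a p q A B n%:R @[n --> \oo] --> 0.
Proof.
move=> a0 p0; have p20 : 0 < p / 2 by rewrite divr_gt0.
have [C C0 hC] := powR_le_expR a0 p20.
apply: norm_cvg0.
apply: (@squeeze_cvgr _ _ _ _ (cst 0) (fun n : nat => (`|A| + `|B|) * (C * expR (- (p / 2 * n%:R))))).
- apply: nearW => n; rewrite /= normr_ge0/=.
  rewrite (le_trans (normr_laplaceK _ _ _ _ _ _))// ler_wpM2l ?addr_ge0//.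
  apply: (le_trans (ler_wpM2r (expR_ge0 _) (hC _ (ler0n _ _)))).
  by rewrite -[leLHS]mulrA -expRD ler_wpM2l ?(ltW C0)// ler_expR; lra.
- exact: cvg_cst.
- rewrite -[X in _ --> X](mulr0 (`|A| + `|B|)); apply: cvgM; first exact: cvg_cst.
  rewrite -[X in _ --> X](mulr0 C); apply: cvgM; first exact: cvg_cst.
  apply: (@cvg_comp _ _ _ (fun n : nat => n%:R) (fun x => expR (- (p / 2 * x)))
    _ (pinfty_nbhs R)); first exact: cvgr_idn.
  apply: (@cvg_comp _ _ _ (fun x => p / 2 * x) (fun x => expR (- x)) _ (pinfty_nbhs R)).
    exact: gt0_cvgMry.
  exact: cvgr_expR.
Qed.

(** The integrand is the derivative of [laplaceK (a + 1) p q A B], which vanishes at 0 since a + 1 >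
    0 and tends to 0 at infinity. The cases (A, B) = (1, 0) and (0, 1) are, up to sign, the real and
    imaginary parts of s L(a + 1, s) = (a + 1) L(a, s). *)
Lemma laplaceI_parts a p q A B : 0 <= a -> 0 < p ->
  (a + 1) * laplaceI a p q A B
  + (- p * laplaceI (a + 1) p q A B + q * laplaceI (a + 1) p q B (- A)) = 0.
Proof.
move=> a0 p0; have a10 : 0 <= a + 1 by rewrite addr_ge0.
pose f x := (a + 1) * laplaceK a p q A B x
  + (- p * laplaceK (a + 1) p q A B x + q * laplaceK (a + 1) p q B (- A) x).
have intZ b c C D : 0 <= b ->
    mu.-integrable `[0, +oo[ (EFin \o (fun x => c * laplaceK b p q C D x)).
  by move=> b0; exact/integrableZ/integrable_laplaceK.
have intf : mu.-integrable `[0, +oo[ (EFin \o f).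
  by apply: integrableDR; [|apply: integrableDR]; exact: (intZ).
rewrite /laplaceI -!RintegralZl//; try exact: integrable_laplaceK.
rewrite -RintegralD//; [|exact: (intZ)|exact: (intZ)].
rewrite -RintegralD//; [|exact: (intZ)|apply: integrableDR; exact: (intZ)].
have cf : {within `[0, +oo[, continuous f}.
  apply/subspace_continuousP => x x0.
  by apply: cvgD; [|apply: cvgD]; (apply: cvgM; [exact: cvg_cst|]);
    move: x x0; apply/subspace_continuousP; exact: within_continuous_laplaceK.
have FTC n : (0 < n)%N ->
    \int[mu]_(x in `[0, n%:R]) f x = laplaceK (a + 1) p q A B n%:R.
  move=> n0; have n0' : 0 < n%:R :> R by rewrite ltr0n.
  rewrite /Rintegral (@continuous_FTC2 R f (laplaceK (a + 1) p q A B)) //=.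
  - by rewrite /laplaceK powR0 ?gt_eqF ?ltr_wpDl// !mul0r subr0.
  - apply: continuous_subspaceW cf => x /=; rewrite !in_itv/= andbT.
    by case/andP.
  - split.
    + move=> x; rewrite in_itv/= => /andP[x0 _].
      exact: (@ex_derive _ _ _ _ _ _ _ (is_derive_laplaceK a p q A B x0)).
    + exact: cvg_at_right_laplaceK.
    + by apply: cvg_at_left_filter; exact: continuous_laplaceK.
  - move=> x; rewrite in_itv/= => /andP[x0 _].
    rewrite derive1E.
    exact: (@derive_val _ _ _ _ _ _ _ (is_derive_laplaceK a p q A B x0)).
have h1 := cvg_Rintegral_itv0n intf.
have h2 := @cvgn_laplaceK (a + 1) p q A B a10 p0.
apply: (cvg_unique _ h1) => //.
apply: cvg_trans h2; apply: near_eq_cvg; near=> n.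
by rewrite FTC//; near: n; exact: nbhs_infty_gt.
Unshelve. all: by end_near. Qed.

End LaplaceParts.

(** * Differentiation in the parameter s *)

Section LaplaceDerive.
Context {R : realType}.
Local Notation mu := (@lebesgue_measure R).
Implicit Types (a p q A B x y t : R) (f g F : R -> R).

(** Letting s move along a line turns d/ds into a real derivative in t. The factor x that comes out
    raises the exponent to a + 1. *)
Lemma is_derive_laplaceK_param a p0 p1 q0 q1 A B x t : 0 <= a -> 0 <= x ->
  is_derive t 1 (fun t => laplaceK a (p0 + p1 * t) (q0 + q1 * t) A B x)
    (- p1 * laplaceK (a + 1) (p0 + p1 * t) (q0 + q1 * t) A B x
     + q1 * laplaceK (a + 1) (p0 + p1 * t) (q0 + q1 * t) B (- A) x).
Proof.
move=> a0 x0.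
have xa1 : x `^ (a + 1) = x `^ a * x.
  move: x0; rewrite le_eqVlt => /predU1P[<-|x0].
    by rewrite mulr0 powR0// gt_eqF// ltr_wpDl.
  by rewrite powRD ?powRr1 ?(ltW x0)// (gt_eqF x0) implybT.
have He : is_derive t 1 (fun t => expR (- (p0 + p1 * t) * x))
    (- p1 * x * expR (- (p0 + p1 * t) * x)).
  apply: is_derive_eq; rewrite /GRing.scale/=; ring.
have Hq : is_derive t 1 (fun t => (q0 + q1 * t) * x) (q1 * x).
  apply: is_derive_eq; rewrite /GRing.scale/=; ring.
have Ht : is_derive t 1 (fun t => trig A B ((q0 + q1 * t) * x))
    (q1 * x * trig B (- A) ((q0 + q1 * t) * x)).
  have Ht' := is_derive_trig A B ((q0 + q1 * t) * x).
  have := @is_derive1_comp _ (trig A B) (fun t => (q0 + q1 * t) * x) t _ _ Ht' Hq.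
  by rewrite [X in is_derive _ _ _ X]mulrC.
rewrite (_ : (fun t => _) = cst (x `^ a) * (fun t => expR (- (p0 + p1 * t) * x))
   * (fun t => trig A B ((q0 + q1 * t) * x))); last by [].
apply: is_derive_eq.
by rewrite !fctE /laplaceK xa1 /GRing.scale/=; ring.
Qed.

Lemma is_derive_laplaceI a p0 p1 q0 q1 A B t : 0 <= a -> 0 < p0 + p1 * t ->
  is_derive t 1 (fun t => laplaceI a (p0 + p1 * t) (q0 + q1 * t) A B)
    (- p1 * laplaceI (a + 1) (p0 + p1 * t) (q0 + q1 * t) A B
     + q1 * laplaceI (a + 1) (p0 + p1 * t) (q0 + q1 * t) B (- A)).
Proof.
move=> a0 pt0; have a10 : 0 <= a + 1 by rewrite addr_ge0.
(* On the interval of radius [d] around t the real part of s drops by at most |p1| d <= m, so it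
   stays above half its value at t and e ^ (- m x) dominates uniformly. The 1 in [d] covers p1 =
   0. *)
pose m := (p0 + p1 * t) / 2; have m0 : 0 < m by rewrite divr_gt0.
pose d := m / (`|p1| + 1); have d0 : 0 < d by rewrite divr_gt0// ltr_wpDl.
pose f t x := laplaceK a (p0 + p1 * t) (q0 + q1 * t) A B x.
pose G x := (`|p1| + `|q1|) * (`|A| + `|B|) * (x `^ (a + 1) * expR (- m * x)).
have It : `]t - d, t + d[%classic t by rewrite /= in_itv/=; apply/andP; split; lra.
have Ip u : `]t - d, t + d[%classic u -> m <= p0 + p1 * u.
  rewrite /= in_itv/= => /andP[u1 u2].
  have ut : `|u - t| <= d by rewrite ler_norml; apply/andP; split; lra.
  have : `|p1 * (u - t)| <= m.
    rewrite normrM (le_trans (ler_wpM2l (normr_ge0 _) ut))//.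
    rewrite /d mulrCA ler_piMr ?(ltW m0)// ler_pdivrMr ?ltr_wpDl// mul1r lerDl.
    exact: ler01.
  rewrite ler_norml => /andP[+ _].
  rewrite /m; lra.
have intf u : `]t - d, t + d[%classic u -> mu.-integrable `[0, +oo[ (EFin \o f u).
  by move=> /Ip mu0; apply: integrable_laplaceK => //; exact: lt_le_trans mu0.
have df u x : `]t - d, t + d[%classic u -> `[0, +oo[%classic x -> derivable (f ^~ x) u 1.
  move=> _; rewrite /= in_itv/= andbT => x0.
  exact: (@ex_derive _ _ _ _ _ _ _ (is_derive_laplaceK_param p0 p1 q0 q1 A B u a0 x0)).
have dfE u x : 0 <= x -> partial1of2 f u x =
   - p1 * laplaceK (a + 1) (p0 + p1 * u) (q0 + q1 * u) A B x
     + q1 * laplaceK (a + 1) (p0 + p1 * u) (q0 + q1 * u) B (- A) x.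
  move=> x0; rewrite partial1of2E.
  exact: (@derive_val _ _ _ _ _ _ _ (is_derive_laplaceK_param p0 p1 q0 q1 A B u a0 x0)).
have G0 x : 0 <= G x by rewrite /G !mulr_ge0 ?powR_ge0 ?expR_ge0 ?addr_ge0.
have intG : mu.-integrable `[0, +oo[ (EFin \o G).
  exact/integrableZ/integrable_powR_expR.
have Gub u x : `]t - d, t + d[%classic u -> `[0, +oo[%classic x -> `|partial1of2 f u x| <= G x.
  move=> /Ip mp; rewrite /= in_itv/= andbT => x0.
  have bnd C D : `|laplaceK (a + 1) (p0 + p1 * u) (q0 + q1 * u) C D x|
      <= (`|C| + `|D|) * (x `^ (a + 1) * expR (- m * x)).
    rewrite (le_trans (normr_laplaceK _ _ _ _ _ _))// ler_wpM2l ?addr_ge0//.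
    by rewrite ler_wpM2l ?powR_ge0// ler_expR ler_wpM2r// lerN2.
  have -> : G x = `|p1| * ((`|A| + `|B|) * (x `^ (a + 1) * expR (- m * x)))
      + `|q1| * ((`|A| + `|B|) * (x `^ (a + 1) * expR (- m * x))) by rewrite /G; ring.
  rewrite dfE//; apply: (le_trans (ler_normD _ _)).
  apply: lerD; rewrite normrM ?normrN; apply: ler_wpM2l => //.
  by have := bnd B (- A); rewrite normrN [`|B| + _]addrC.
apply: DeriveDef.
  exact: (@derivable_under_integral _ _ _ mu f _ _ _ _ _ It intf df G G0 intG Gub).
rewrite -derive1E.
have -> := @differentiation_under_integral _ _ _ mu f _ _ _ _ _ It intf df G G0 intG Gub; try by [].
have intK C D : mu.-integrable `[0, +oo[
    (EFin \o laplaceK (a + 1) (p0 + p1 * t) (q0 + q1 * t) C D).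
  exact: integrable_laplaceK.
have intZ c C D : mu.-integrable `[0, +oo[
    (EFin \o (fun x => c * laplaceK (a + 1) (p0 + p1 * t) (q0 + q1 * t) C D x)).
  exact: integrableZ.
rewrite /laplaceI -!RintegralZl// -RintegralD//.
apply: eq_Rintegral => x /set_mem/=; rewrite in_itv/= andbT => x0.
exact: dfE.
Qed.

End LaplaceDerive.

(** * Evaluation of the Laplace integral of a power *)

Section LaplaceEval.
Context {R : realType}.
Local Notation mu := (@lebesgue_measure R).
Implicit Types (a p q A B x y t : R) (f g F : R -> R).

Lemma laplaceIN a p q A B : 0 <= a -> 0 < p ->
  laplaceI a p q (- A) (- B) = - laplaceI a p q A B.
Proof.
move=> a0 p0; rewrite -[RHS]mulN1r -RintegralZl//; last exact: integrable_laplaceK.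
by apply: eq_Rintegral => x _; rewrite /laplaceK /trig; ring.
Qed.

Lemma laplaceIN01 a p q : 0 <= a -> 0 < p ->
  laplaceI a p q 0 (- 1) = - laplaceI a p q 0 1.
Proof. by move=> a0 p0; rewrite -laplaceIN// oppr0. Qed.

Lemma eq_segment01 f : (forall t, 0 <= t <= 1 -> is_derive t 1 f 0) -> f 1 = f 0.
Proof.
move=> df; apply/eqP; rewrite -subr_eq0; apply/eqP.
have [||c _ ->] := @MVT_segment R f (fun=> 0) 0 1 ler01; last by rewrite mul0r.
  by move=> x; rewrite in_itv/= => /andP[x0 x1]; apply: df; rewrite !ltW.
apply: derivable_within_continuous => x; rewrite in_itv/= => x01.
exact: (@ex_derive _ _ _ _ _ _ _ (df x x01)).
Qed.

(* With s(t) = 1 + (s - 1) t, the functions E * (Lc * C + Ls * S) and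
   E * (Lc * S - Ls * C) of the proof are the real and imaginary parts of
   s(t) ^ (a + 1) L(a, s(t)); integration by parts makes their
   derivatives vanish. *)
Lemma laplaceI_eval a p q (r := ln (p ^+ 2 + q ^+ 2) / 2) (w := atan (q / p)) :
  0 <= a -> 0 < p ->
  laplaceI a p q 1 0 = laplaceI a 1 0 1 0 * (expR (- (a + 1) * r) * cos ((a + 1) * w))
  /\ laplaceI a p q 0 1 = laplaceI a 1 0 1 0 * (expR (- (a + 1) * r) * sin ((a + 1) * w)).
Proof.
move=> a0 p0; have a10 : 0 <= a + 1 by rewrite addr_ge0.
pose P t := 1 + (p - 1) * t; pose Q t := 0 + q * t.
have P0 t : 0 <= t <= 1 -> 0 < P t.
  move=> /andP[t0]; rewrite le_eqVlt => /predU1P[->|t1]; first by rewrite /P; lra.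
  by rewrite /P; nra.
(* Real and imaginary parts of the principal logarithm of s(t) = P t + i Q t; the arctangent gives
   the argument because P t > 0 on the whole segment. *)
pose r_ t := ln (P t ^+ 2 + Q t ^+ 2) / 2; pose w_ t := atan (Q t / P t).
pose Lc t := laplaceI a (P t) (Q t) 1 0; pose Ls t := laplaceI a (P t) (Q t) 0 1.
have dP t : is_derive t 1 P (p - 1).
  by rewrite /P; apply: is_derive_eq; rewrite /GRing.scale/=; ring.
have dQ t : is_derive t 1 Q q.
  by rewrite /Q; apply: is_derive_eq; rewrite /GRing.scale/=; ring.
have dr t : 0 <= t <= 1 ->
    is_derive t 1 r_ ((P t * (p - 1) + Q t * q) / (P t ^+ 2 + Q t ^+ 2)).
  move=> /P0 Pt; have D0 : 0 < P t ^+ 2 + Q t ^+ 2 by rewrite ltr_wpDr ?sqr_ge0// exprn_gt0.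
  have dD : is_derive t 1 (fun t => P t ^+ 2 + Q t ^+ 2) (2 * (P t * (p - 1) + Q t * q)).
    rewrite (_ : (fun t => _) = P * P + Q * Q); last first.
      by apply/funext => u; rewrite !fctE !expr2.
    have dPQ := is_deriveD (is_deriveM (dP t) (dP t)) (is_deriveM (dQ t) (dQ t)).
    by apply: (@is_derive_eq _ _ _ _ _ _ _ _ dPQ); rewrite /GRing.scale/=; ring.
  have dl := is_derive1_ln D0.
  have := @is_derive1_comp _ (@ln R) (fun t => P t ^+ 2 + Q t ^+ 2) t _ _ dl dD.
  move=> dc; rewrite /r_ (_ : (fun t => _) = ((@ln R) \o (fun t => P t ^+ 2 + Q t ^+ 2)) * cst 2^-1)//.
  apply: is_derive_eq; rewrite !fctE /GRing.scale/=; field.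
  by rewrite gt_eqF.
have dw t : 0 <= t <= 1 ->
    is_derive t 1 w_ ((P t * q - Q t * (p - 1)) / (P t ^+ 2 + Q t ^+ 2)).
  move=> /P0 Pt; have D0 : 0 < P t ^+ 2 + Q t ^+ 2 by rewrite ltr_wpDr ?sqr_ge0// exprn_gt0.
  have dV : is_derive t 1 (fun t => (P t)^-1) (- (P t) ^- 2 *: (p - 1)).
    by apply: is_deriveV; rewrite gt_eqF.
  have dD : is_derive t 1 (fun t => Q t / P t) ((P t * q - Q t * (p - 1)) / P t ^+ 2).
    rewrite (_ : (fun t => _) = Q * (fun t => (P t)^-1))//.
    apply: is_derive_eq; rewrite /GRing.scale/=; field.
    by rewrite gt_eqF.
  have dl := is_derive1_atan (Q t / P t).
  have := @is_derive1_comp _ (@atan R) (fun t => Q t / P t) t _ _ dl dD.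
  move=> dc; apply: (@is_derive_eq _ _ _ _ _ _ _ _ dc); field.
  by rewrite !gt_eqF//.
have dLc t : 0 <= t <= 1 -> is_derive t 1 Lc
    (- (p - 1) * laplaceI (a + 1) (P t) (Q t) 1 0 - q * laplaceI (a + 1) (P t) (Q t) 0 1).
  move=> /P0 Pt; have := @is_derive_laplaceI _ a 1 (p - 1) 0 q 1 0 t a0 Pt.
  by rewrite laplaceIN01// mulrN.
have dLs t : 0 <= t <= 1 -> is_derive t 1 Ls
    (- (p - 1) * laplaceI (a + 1) (P t) (Q t) 0 1 + q * laplaceI (a + 1) (P t) (Q t) 1 0).
  move=> /P0 Pt; have := @is_derive_laplaceI _ a 1 (p - 1) 0 q 0 1 t a0 Pt.
  by rewrite oppr0.
have eLc t : 0 <= t <= 1 -> (a + 1) * Lc t =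
    P t * laplaceI (a + 1) (P t) (Q t) 1 0 + Q t * laplaceI (a + 1) (P t) (Q t) 0 1.
  move=> /P0 Pt; have := @laplaceI_parts _ a (P t) (Q t) 1 0 a0 Pt.
  rewrite laplaceIN01// -/(Lc t); lra.
have eLs t : 0 <= t <= 1 -> (a + 1) * Ls t =
    P t * laplaceI (a + 1) (P t) (Q t) 0 1 - Q t * laplaceI (a + 1) (P t) (Q t) 1 0.
  move=> /P0 Pt; have := @laplaceI_parts _ a (P t) (Q t) 0 1 a0 Pt.
  rewrite oppr0 -/(Ls t); lra.
pose E t := expR ((a + 1) * r_ t).
pose C t := cos ((a + 1) * w_ t); pose S t := sin ((a + 1) * w_ t).
have dE t : 0 <= t <= 1 -> is_derive t 1 E
    (E t * ((a + 1) * ((P t * (p - 1) + Q t * q) / (P t ^+ 2 + Q t ^+ 2)))).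
  move=> t01; have dr' := dr t t01.
  have d1 : is_derive t 1 (fun t => (a + 1) * r_ t) ((a + 1) * ((P t * (p - 1) + Q t * q) / (P t ^+ 2 + Q t ^+ 2))).
    rewrite (_ : (fun t => _) = cst (a + 1) * r_)//.
    by apply: is_derive_eq; rewrite !fctE /GRing.scale/=; ring.
  exact: (@is_derive1_comp _ (@expR R) (fun t => (a + 1) * r_ t) t _ _ (is_derive_expR _) d1).
have dCS t : 0 <= t <= 1 ->
    is_derive t 1 C (- S t * ((a + 1) * ((P t * q - Q t * (p - 1)) / (P t ^+ 2 + Q t ^+ 2)))) /\
    is_derive t 1 S (C t * ((a + 1) * ((P t * q - Q t * (p - 1)) / (P t ^+ 2 + Q t ^+ 2)))).
  move=> t01; have dw' := dw t t01.
  have d1 : is_derive t 1 (fun t => (a + 1) * w_ t) ((a + 1) * ((P t * q - Q t * (p - 1)) / (P t ^+ 2 + Q t ^+ 2))).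
    rewrite (_ : (fun t => _) = cst (a + 1) * w_)//.
    by apply: is_derive_eq; rewrite !fctE /GRing.scale/=; ring.
  split.
    exact: (@is_derive1_comp _ (@cos R) (fun t => (a + 1) * w_ t) t _ _ (is_derive_cos _) d1).
  exact: (@is_derive1_comp _ (@sin R) (fun t => (a + 1) * w_ t) t _ _ (is_derive_sin _) d1).
have M1 : (E * (Lc * C + Ls * S)) 1 = (E * (Lc * C + Ls * S)) 0.
  apply: eq_segment01 => t t01.
  have D0 : P t ^+ 2 + Q t ^+ 2 != 0.
    by rewrite gt_eqF// ltr_wpDr ?sqr_ge0// exprn_gt0// P0.
  have dE' := dE _ t01; have [dC' dS'] := dCS _ t01.
  have dLc' := dLc _ t01; have dLs' := dLs _ t01.
  have dM := is_deriveM dE' (is_deriveD (is_deriveM dLc' dC') (is_deriveM dLs' dS')).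
  apply: (@is_derive_eq _ _ _ _ _ _ _ _ dM); rewrite !fctE /GRing.scale/=.
  move: D0 (eLc _ t01) (eLs _ t01); rewrite -/(Lc t) -/(Ls t).
  set U := (P t * (p - 1) + Q t * q) / (P t ^+ 2 + Q t ^+ 2).
  set W := (P t * q - Q t * (p - 1)) / (P t ^+ 2 + Q t ^+ 2) => D0 e1 e2.
  (* U and W are the derivatives of [r_] and [w_]. Grouped this way, Lc and Ls occur only multiplied
     by a + 1, so integration by parts rewrites everything in integrals of exponent a + 1, where the
     terms cancel. *)
  transitivity (E t * (U * ((a + 1) * Lc t * C t + (a + 1) * Ls t * S t)
    + W * ((a + 1) * Ls t * C t - (a + 1) * Lc t * S t)
    + (- (p - 1) * laplaceI (a + 1) (P t) (Q t) 1 0 - q * laplaceI (a + 1) (P t) (Q t) 0 1) * C t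
    + (- (p - 1) * laplaceI (a + 1) (P t) (Q t) 0 1 + q * laplaceI (a + 1) (P t) (Q t) 1 0) * S t)).
    ring.
  rewrite e1 e2 /U /W; field; exact: D0.
have M2 : (E * (Lc * S - Ls * C)) 1 = (E * (Lc * S - Ls * C)) 0.
  apply: eq_segment01 => t t01.
  have D0 : P t ^+ 2 + Q t ^+ 2 != 0.
    by rewrite gt_eqF// ltr_wpDr ?sqr_ge0// exprn_gt0// P0.
  have dE' := dE _ t01; have [dC' dS'] := dCS _ t01.
  have dLc' := dLc _ t01; have dLs' := dLs _ t01.
  apply: is_derive_eq; rewrite !fctE /GRing.scale/=.
  move: D0 (eLc _ t01) (eLs _ t01); rewrite -/(Lc t) -/(Ls t).
  set U := (P t * (p - 1) + Q t * q) / (P t ^+ 2 + Q t ^+ 2).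
  set W := (P t * q - Q t * (p - 1)) / (P t ^+ 2 + Q t ^+ 2) => D0 e1 e2.
  transitivity (E t * (U * ((a + 1) * Lc t * S t - (a + 1) * Ls t * C t)
    + W * ((a + 1) * Ls t * S t + (a + 1) * Lc t * C t)
    + (- (p - 1) * laplaceI (a + 1) (P t) (Q t) 1 0 - q * laplaceI (a + 1) (P t) (Q t) 0 1) * S t
    - (- (p - 1) * laplaceI (a + 1) (P t) (Q t) 0 1 + q * laplaceI (a + 1) (P t) (Q t) 1 0) * C t)).
    ring.
  rewrite e1 e2 /U /W; field; exact: D0.
(* At t = 0 the logarithm of s(0) = 1 vanishes and L(a, 1) is real, so the two invariants equal
   Gamma (a + 1) and 0. *)
have P00 : P 0 = 1 by rewrite /P mulr0 addr0.
have Q00 : Q 0 = 0 by rewrite /Q mulr0 addr0.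
have P01 : P 1 = p by rewrite /P; ring.
have Q01 : Q 1 = q by rewrite /Q; ring.
have r0 : r_ 0 = 0 by rewrite /r_ P00 Q00 expr0n/= addr0 expr1n ln1 mul0r.
have w0 : w_ 0 = 0 by rewrite /w_ P00 Q00 mul0r atan0.
have r1 : r_ 1 = r by rewrite /r_ P01 Q01.
have w1 : w_ 1 = w by rewrite /w_ P01 Q01.
have Ls0 : laplaceI a 1 0 0 1 = 0.
  rewrite /laplaceI -[RHS](_ : \int[mu]_(x in `[0, +oo[) 0 = 0); last by rewrite Rintegral_cst// mul0r.
  by apply: eq_Rintegral => x _; rewrite /laplaceK /trig !mul0r sin0; ring.
move: M1 M2; rewrite !fctE /E /C /S /Lc /Ls P00 Q00 P01 Q01 r0 w0 r1 w1 Ls0.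
rewrite !mulr0 expR0 cos0 sin0 !(mulr1, mul1r, mul0r, mulr0, addr0, subr0).
set L1 := laplaceI a p q 1 0; set L2 := laplaceI a p q 0 1; set G := laplaceI a 1 0 1 0.
have CS : cos ((a + 1) * w) ^+ 2 + sin ((a + 1) * w) ^+ 2 = 1 by rewrite cos2Dsin2.
have eE : expR (- (a + 1) * r) * expR ((a + 1) * r) = 1.
  by rewrite -expRD mulNr addNr expR0.
move: CS eE; move: (cos _) (sin _) (expR _) (expR (- _ * _)) => c s e E' CS eE m1 m2.
have h1 : L1 * c + L2 * s = E' * G.
  by rewrite -m1 mulrA eE mul1r.
have h2 : L1 * s - L2 * c = 0.
  by rewrite -[LHS]mul1r -eE -mulrA m2 mulr0.
(* The matrix with rows (c, s) and (s, - c) is its own inverse, as c ^ 2 + s ^ 2 = 1. *)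
split.
- transitivity (c * (L1 * c + L2 * s) + s * (L1 * s - L2 * c)).
    transitivity (L1 * (c ^+ 2 + s ^+ 2)); first by rewrite CS mulr1.
    ring.
  by rewrite h1 h2; ring.
- transitivity (s * (L1 * c + L2 * s) - c * (L1 * s - L2 * c)).
    transitivity (L2 * (c ^+ 2 + s ^+ 2)); first by rewrite CS mulr1.
    ring.
  by rewrite h1 h2; ring.
Qed.

End LaplaceEval.

(** * The real Gamma function *)

Section RealGamma.
Context {R : realType}.
Local Notation mu := (@lebesgue_measure R).
Implicit Types (a c p q A B x y t : R) (f g F : R -> R).

(* Euler's integral for Gamma (a + 1). *)
Definition rgamma a := laplaceI a 1 0 1 0.

Lemma rgammaE a : rgamma a = \int[mu]_(x in `[0, +oo[) (x `^ a * expR (- x)).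
Proof.
apply: eq_Rintegral => x _.
by rewrite /laplaceK /trig mulN1r mul0r cos0 sin0 mulr0 addr0 !mulr1.
Qed.

Lemma integrable_rgamma a : 0 <= a ->
  mu.-integrable `[0, +oo[ (EFin \o (fun x => x `^ a * expR (- x))).
Proof.
move=> a0; have := integrable_powR_expR a0 (@ltr01 R).
by apply: eq_integrable => // x _ /=; rewrite mulN1r.
Qed.

Lemma rgammaS a : 0 <= a -> rgamma (a + 1) = (a + 1) * rgamma a.
Proof.
move=> a0; have := @laplaceI_parts _ a 1 0 1 0 a0 ltr01.
rewrite mul0r addr0 mulN1r => /eqP; rewrite subr_eq0 => /eqP h.
exact: esym.
Qed.

Lemma rgamma0 : rgamma 0 = 1.
Proof.
rewrite rgammaE -[RHS]/(fine 1%:E) -(@integral_exponential_pdf R 1 ltr01).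
rewrite /Rintegral -[X in fine (integral _ X _)](@classical_sets.setTI _ `[0, +oo[%classic).
rewrite integral_mkcondr; congr fine; apply: eq_integral => x _.
rewrite patchE; case: ifPn => [/set_mem/=|].
  rewrite in_itv/= andbT => x0.
  rewrite exponential_pdfE//= powRr0 !mul1r. by rewrite mulN1r.
rewrite notin_setE/= in_itv/= andbT => /negP; rewrite -ltNge => x0.
by rewrite lt0_exponential_pdf.
Qed.

(* Markov's inequality for the density t ^ a * exp (- t). *)
Lemma rgammaD_ge a c M : 1 <= a -> 0 <= c -> 0 < M ->
  M `^ c * (rgamma a * (1 - M / a)) <= rgamma (a + c).
Proof.
move=> a1 c0 M0; have a0 : 0 <= a - 1 by rewrite subr_ge0.
have a00 : 0 < a by exact: lt_le_trans a1.
have ac0 : 0 <= a + c by rewrite addr_ge0// ltW.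
(* With 1 - M / x in place of the indicator of x >= M the bound becomes pointwise, x ^ (a + c) >= M
   ^ c (x ^ a - M x ^ (a - 1)), and both terms integrate to Gamma values. *)
have -> : M `^ c * (rgamma a * (1 - M / a)) =
    M `^ c * rgamma a + (- (M `^ c * M)) * rgamma (a - 1).
  have := rgammaS a0; rewrite subrK => ->; field.
  by rewrite gt_eqF.
have i1 := integrableZ (M `^ c) (integrable_rgamma (ltW a00)).
have i2 := integrableZ (- (M `^ c * M)) (integrable_rgamma a0).
rewrite !rgammaE -!RintegralZl//; [|exact: integrable_rgamma|exact/integrable_rgamma/ltW].
rewrite -RintegralD//.
apply: le_Rintegral => //; [exact: integrableDR|exact: integrable_rgamma|].
move=> x /=; rewrite in_itv/= andbT => x0.
rewrite !mulrA -mulrDl ler_wpM2r ?expR_ge0//.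
have -> : x `^ a = x * x `^ (a - 1) by rewrite mulr_powRB1.
have [->|xn0] := eqVneq x 0.
  rewrite [0 `^ (a + c)]powR0 ?gt_eqF ?(lt_le_trans a00) ?lerDl//.
  by rewrite mul0r mulr0 add0r mulNr oppr_le0 !mulr_ge0 ?powR_ge0// ltW.
have x0' : 0 < x by rewrite lt_def xn0.
rewrite [x `^ (a + c)]powRD ?xn0 ?implybT// -[x `^ a]mulr_powRB1//.
have y0 : 0 <= x `^ (a - 1) by rewrite powR_ge0.
rewrite [leLHS](_ : _ = (M `^ c * (x - M)) * x `^ (a - 1)); last by ring.
rewrite [leRHS](_ : _ = (x `^ c * x) * x `^ (a - 1)); last by ring.
rewrite ler_wpM2r//; have [Mx|xM] := leP M x; last first.
  rewrite (@le_trans _ _ 0) ?mulr_ge0 ?powR_ge0//.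
  by rewrite mulr_ge0_le0 ?powR_ge0// subr_le0 ltW.
apply: ler_pM; rewrite ?powR_ge0 ?subr_ge0//.
  by rewrite ge0_ler_powR ?nnegrE// ltW.
by rewrite gerBl ltW.
Qed.

Lemma rgamma_nat_gt0 n : 0 < rgamma n%:R.
Proof.
elim: n => [|n IH]; first by rewrite rgamma0 ltr01.
by rewrite -addn1 natrD rgammaS// mulr_gt0// -natr1 ltr_wpDl.
Qed.

(** Positivity spreads from the integers, where the recurrence gives it, by [rgammaD_ge] with M = 1.
    The shift by 2 provides an integer m >= 2 below the argument, so that 1 - 1 / m > 0. *)
Lemma rgamma_gt0 a : 0 <= a -> 0 < rgamma a.
Proof.
move=> a0; suff : 0 < rgamma (a + 1 + 1).
  rewrite rgammaS ?addr_ge0// rgammaS// pmulr_rgt0 ?ltr_wpDl ?addr_ge0//.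
  by rewrite pmulr_rgt0 ?ltr_wpDl.
set b := a + 1 + 1; have b2 : 2 <= b by rewrite /b; lra.
clearbody b; have [m m2 mb] : exists2 m : nat, 2 <= m%:R :> R & m%:R <= b.
  exists (Num.truncn b); last by rewrite truncn_le; lra.
  by rewrite ler_nat truncn_ge_nat//; lra.
have := @rgammaD_ge m%:R (b - m%:R) 1.
rewrite subrKC powR1 mul1r => /(_ _ _ ltr01) h.
apply: lt_le_trans (h _ _); [|clear -m2; lra|clear -mb; lra].
by rewrite mulr_gt0 ?rgamma_nat_gt0// mul1r subr_gt0 invf_lt1; clear -m2; lra.
Qed.

Lemma rgammaDn_le a (N : nat) : 0 <= a -> rgamma (a + N%:R) <= (a + N%:R) ^+ N * rgamma a.
Proof.
move=> a0; elim: N => [|N IH]; first by rewrite addr0 mul1r.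
have aN : 0 <= a + N%:R by rewrite addr_ge0.
have aN1 : 0 <= a + N%:R + 1 by rewrite addr_ge0.
rewrite -natr1 addrA rgammaS// exprS -mulrA.
apply: ler_wpM2l => //; apply: (le_trans IH).
apply: ler_wpM2r; first exact/ltW/rgamma_gt0.
by apply: lerXn2r; rewrite ?nnegrE// lerDl.
Qed.

(** Pointwise x ^ (a + c) <= x ^ a + x ^ (a + N), the first term serving for x < 1 and the second
    for x >= 1. This reduces a real shift to the integer one. *)
Lemma rgammaD_le a c (N : nat) : 0 <= a -> 0 <= c <= N%:R ->
  rgamma (a + c) <= (1 + (a + N%:R) ^+ N) * rgamma a.
Proof.
move=> a0 /andP[c0 cN].
have aN : 0 <= a + N%:R by rewrite addr_ge0.
have ac : 0 <= a + c by rewrite addr_ge0.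
rewrite mulrDl mul1r; apply: le_trans (lerD (lexx _) (rgammaDn_le N a0)).
have i0 := integrable_rgamma a0; have iN := integrable_rgamma aN.
rewrite !rgammaE -RintegralD//.
apply: le_Rintegral => //; [exact: integrable_rgamma|exact: integrableDR|].
move=> x /=; rewrite in_itv/= andbT => x0; rewrite -mulrDl ler_wpM2r ?expR_ge0//.
have [x1|x1] := leP 1 x.
  by rewrite (@le_trans _ _ (x `^ (a + N%:R))) ?lerDr ?powR_ge0// ler_powR// lerD2l.
rewrite (@le_trans _ _ (x `^ a)) ?lerDl ?powR_ge0//.
have [->|xn0] := eqVneq x 0.
  have [->|cn0] := eqVneq c 0; first by rewrite addr0.
  by rewrite powR0 ?powR_ge0// gt_eqF// ltr_wpDl// lt_def cn0.
by rewrite ger_powR ?(ltW x1) ?lerDl// lt_def xn0 x0.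
Qed.

End RealGamma.

(** * Gamma on vertical lines *)

Section GammaOscillation.
Context {R : realType}.
Local Notation mu := (@lebesgue_measure R).
Implicit Types (a c p q A B x y t : R) (f g F : R -> R).

Lemma normr_sin_le y : `|sin y| <= `|y|.
Proof.
have h (z : R) : 0 <= z -> `|sin z| <= z.
  move=> z0; have [|c _] := @MVT_segment R sin cos 0 z z0.
    by apply: derivable_within_continuous => x _; exact: derivable_sin.
  rewrite sin0 !subr0 => ->.
  by rewrite normrM (ger0_norm z0) ler_piMl// cos_max.
have [y0|y0] := leP 0 y; first by rewrite (ger0_norm y0) h.
by rewrite -normrN -sinN (ltr0_norm y0) h// oppr_ge0 ltW.
Qed.

Lemma cos_ge_parabola y : 1 - y ^+ 2 / 2 <= cos y.
Proof.
have -> : cos y = 1 - 2 * sin (y / 2) ^+ 2.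
  rewrite -{1}[y](_ : y / 2 + y / 2 = _); last by lra.
  have := cos2Dsin2 (y / 2); rewrite cosD !expr2; lra.
have := normr_sin_le (y / 2); rewrite -(@ler_sqr _ `|_|) ?nnegrE//.
rewrite !real_normK ?num_real// expr_div_n; lra.
Qed.

(** The right-hand side is (2 sinh (y / 2)) ^ 2, and z <= sinh z for z >= 0 by the mean value
    theorem, as cosh >= 1. *)
Lemma sqr_le_expRD y : y ^+ 2 <= expR y + expR (- y) - 2.
Proof.
have h (z : R) : 0 <= z -> 2 * z <= expR z - expR (- z).
  move=> z0.
  pose F x := expR x - expR (- x) - 2 * x : R.
  have dF x : is_derive x 1 F (expR x + expR (- x) - 2).
    by apply: is_derive_eq; rewrite /GRing.scale/=; ring.
  have F0 : F 0 = 0 by rewrite /F mulr0 oppr0 expR0 subrr addr0.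
  have [|c _] := @MVT_segment R F (fun x => expR x + expR (- x) - 2) 0 z z0.
    apply: derivable_within_continuous => x _.
    exact: (@ex_derive _ _ _ _ _ _ _ (dF x)).
  rewrite F0 !subr0 => h.
  rewrite -subr_ge0 -/(F z) h mulr_ge0//.
  rewrite expRN; have e0 := expR_gt0 c.
  have -> : expR c + (expR c)^-1 - 2 = (expR c - 1) ^+ 2 / expR c.
    by field; rewrite gt_eqF.
  by rewrite divr_ge0 ?sqr_ge0// ltW.
have h2 (z : R) : 0 <= z -> z ^+ 2 <= expR z + expR (- z) - 2.
  move=> z0; have z20 : 0 <= z / 2 by rewrite divr_ge0.
  have -> : expR z + expR (- z) - 2 = (expR (z / 2) - expR (- (z / 2))) ^+ 2.
    rewrite sqrrB -!expRM_natl -expRD subrr expR0 mulrN !(mulrC 2) divfK//; lra.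
  have -> : z ^+ 2 = (2 * (z / 2)) ^+ 2 by congr (_ ^+ 2); lra.
  have := h _ z20; have : 0 <= 2 * (z / 2) by rewrite mulr_ge0.
  by move: (2 * _) (_ - _) => u v u0 uv; rewrite lerXn2r ?nnegrE// (le_trans u0).
have [y0|y0] := leP 0 y; first exact: h2.
by have := h2 (- y); rewrite sqrrN opprK [expR (- y) + _]addrC; apply; rewrite oppr_ge0 ltW.
Qed.

(* cos y >= 1 - y ^ 2 / 2 and (ln u) ^ 2 <= u + 1 / u - 2 turn the oscillating
   factor into powers of t, whose integrals are again Gamma values. *)
Lemma cos_ln_ge q m t : 0 < m -> 0 < t ->
  1 - q ^+ 2 / 2 * (t / m + m / t - 2) <= cos (q * ln t - q * ln m).
Proof.
move=> m0 t0; apply: le_trans (cos_ge_parabola _).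
rewrite lerD2l lerN2 -mulrBr exprMn mulrAC ler_wpM2l ?divr_ge0 ?sqr_ge0//.
have -> : ln t - ln m = ln (t / m) by rewrite ln_div.
apply: le_trans (sqr_le_expRD _) _.
by rewrite expRN lnK ?posrE ?divr_gt0// invf_div.
Qed.

(* Real and imaginary parts of Gamma (a + 1 + iq), at (A, B) = (1, 0) and
   (0, 1). *)
Definition gammaI a q A B :=
  \int[mu]_(t in `[0, +oo[) (t `^ a * expR (- t) * trig A B (q * ln t)).

Lemma integrable_gammaI a q A B : 0 <= a ->
  mu.-integrable `[0, +oo[ (EFin \o (fun t => t `^ a * expR (- t) * trig A B (q * ln t))).
Proof.
move=> a0.
apply: (@le_integrable _ _ _ mu _ _ _
   (EFin \o (fun t => (`|A| + `|B|) * (t `^ a * expR (- t))))) => //.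
- apply/measurable_EFinP; apply: measurable_funM.
    apply: measurable_funM; first exact: measurable_funTS.
    by apply: measurable_funTS; apply: measurableT_comp.
  apply: measurable_funTS.
  apply: (@measurableT_comp _ _ _ _ _ _ (trig A B) _ (fun t => q * ln t)).
    by apply: continuous_measurable_fun; exact: continuous_trig.
  by apply: measurable_funM => //; exact: measurable_ln.
- move=> t/= _; rewrite lee_fin.
  have h : 0 <= t `^ a * expR (- t) by rewrite mulr_ge0 ?powR_ge0 ?expR_ge0.
  have h2 : 0 <= (`|A| + `|B|) * (t `^ a * expR (- t)) by rewrite mulr_ge0 ?addr_ge0.
  rewrite [leRHS](ger0_norm h2) normrM mulrC (ger0_norm h).
  exact/(ler_wpM2r h)/normr_trig.
- exact/integrableZ/integrable_rgamma.
Qed.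

Lemma gammaIE a q A B : 0 <= a ->
  gammaI a q A B = A * gammaI a q 1 0 + B * gammaI a q 0 1.
Proof.
move=> a0; rewrite /gammaI -!RintegralZl//; try exact: integrable_gammaI.
rewrite -RintegralD//; try exact/integrableZ/integrable_gammaI.
by apply: eq_Rintegral => t _; rewrite /trig; ring.
Qed.

Lemma normr_gammaI a q A B : 0 <= a -> `|gammaI a q A B| <= (`|A| + `|B|) * rgamma a.
Proof.
move=> a0; have Ig := integrable_gammaI q A B a0.
apply: (le_trans (le_normr_Rintegral _ Ig)) => //.
rewrite rgammaE -RintegralZl//; last exact: integrable_rgamma.
apply: le_Rintegral => //.
- by apply: (@integrable_norm _ _ _ mu).
- exact/integrableZ/integrable_rgamma.
move=> t _.
have h : 0 <= t `^ a * expR (- t) by rewrite mulr_ge0 ?powR_ge0 ?expR_ge0.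
rewrite normrM mulrC (ger0_norm h).
exact/(ler_wpM2r h)/normr_trig.
Qed.

(* The right-hand side is the real part of
   a ^ (- iq) Gamma (a + 1 + iq). *)
Lemma gammaI_ge a q : 1 <= a ->
  rgamma a * (1 - q ^+ 2 / (2 * a)) <= gammaI a q (cos (q * ln a)) (sin (q * ln a)).
Proof.
move=> a1; have a0 : 0 <= a - 1 by rewrite subr_ge0.
have a00 : 0 < a by exact: lt_le_trans a1.
have a10 : 0 <= a + 1 by rewrite addr_ge0// ltW.
(* This is the integral of [cos_ln_ge] at m = a. Under the weight t ^ a e ^ (- t), t / a has mean (a
   + 1) / a and a / t has mean 1, so t / a + a / t - 2 has mean only 1 / a. *)
have -> : rgamma a * (1 - q ^+ 2 / (2 * a)) = (1 + q ^+ 2) * rgamma a +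
    ((- (q ^+ 2 / 2 / a)) * rgamma (a + 1) + (- (q ^+ 2 / 2 * a)) * rgamma (a - 1)).
  have := rgammaS a0; rewrite (rgammaS (ltW a00)) subrK => ->; field.
  by rewrite gt_eqF.
have i1 := integrableZ (1 + q ^+ 2) (integrable_rgamma (ltW a00)).
have i2 := integrableZ (- (q ^+ 2 / 2 / a)) (integrable_rgamma a10).
have i3 := integrableZ (- (q ^+ 2 / 2 * a)) (integrable_rgamma a0).
have i23 := integrableDR i2 i3.
rewrite !rgammaE -!RintegralZl//; [|exact: integrable_rgamma|exact: integrable_rgamma|exact/integrable_rgamma/ltW].
rewrite -RintegralD// -RintegralD//.
apply: le_Rintegral => //; [exact: integrableDR|exact/integrable_gammaI/ltW|].
move=> t /=; rewrite in_itv/= andbT => t0.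
have [->|tn0] := eqVneq t 0.
  rewrite ![0 `^ a]powR0 ?(gt_eqF a00)// [0 `^ (a + 1)]powR0; last first.
    by rewrite gt_eqF// ltr_wpDl// ltW.
  have qa0 : 0 <= q ^+ 2 / 2 * a by rewrite mulr_ge0 ?divr_ge0 ?sqr_ge0// ltW.
  rewrite !mul0r !mulr0 !add0r mulNr oppr_le0.
  by apply: (mulr_ge0 qa0); rewrite mulr_ge0 ?powR_ge0 ?expR_ge0.
have {}t0 : 0 < t by rewrite lt_def tn0.
have ta : t `^ a = t `^ (a - 1) * t by rewrite mulrC mulr_powRB1// ltW.
have ta1 : t `^ (a + 1) = t `^ a * t.
  by rewrite powRD ?tn0 ?implybT// powRr1// ltW.
have -> : trig (cos (q * ln a)) (sin (q * ln a)) (q * ln t) = cos (q * ln t - q * ln a).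
  by rewrite cosB /trig mulrC [X in _ + X]mulrC.
have h : 0 <= t `^ a * expR (- t) by rewrite mulr_ge0 ?powR_ge0 ?expR_ge0.
have := ler_wpM2l h (cos_ln_ge q a00 t0).
apply: le_trans.
rewrite le_eqVlt; apply/orP; left; apply/eqP.
rewrite ta1 ta; field.
by rewrite tn0 gt_eqF.
Qed.

End GammaOscillation.

(** * Complex exponential, logarithm and Gamma *)

Section ComplexElementary.
Context {R : realType}.
Implicit Types (x y t : R) (z w : R[i]).
Local Notation nc := (@ComplexField.Normc.normc R).

Lemma ReD z w : complex.Re (z + w) = complex.Re z + complex.Re w.
Proof. by case: z w => [a b] [c d]. Qed.

Lemma ImD z w : complex.Im (z + w) = complex.Im z + complex.Im w.
Proof. by case: z w => [a b] [c d]. Qed.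

Lemma ReN z : complex.Re (- z) = - complex.Re z.
Proof. by case: z. Qed.

Lemma ImN z : complex.Im (- z) = - complex.Im z.
Proof. by case: z. Qed.

Lemma natC k : k%:R = (k%:R : R)%:C :> R[i].
Proof. by rewrite rmorph_nat. Qed.

Lemma normc_ge0 z : 0 <= nc z.
Proof. by case: z => a b; exact: sqrtr_ge0. Qed.

Lemma normr_Re_le z : `|complex.Re z| <= nc z.
Proof. by case: z => a b /=; rewrite -sqrtr_sqr ler_wsqrtr// lerDl sqr_ge0. Qed.

Lemma normr_Im_le z : `|complex.Im z| <= nc z.
Proof. by case: z => a b /=; rewrite -sqrtr_sqr ler_wsqrtr// lerDr sqr_ge0. Qed.

Lemma normc_real x : nc x%:C = `|x|.
Proof. by rewrite /= expr0n/= addr0 sqrtr_sqr. Qed.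

Lemma normc_le_Re_Im z : nc z <= `|complex.Re z| + `|complex.Im z|.
Proof.
case: z => a b /=; rewrite -[leRHS]ger0_norm ?addr_ge0// -sqrtr_sqr.
apply: ler_wsqrtr; rewrite sqrrD !real_normK ?num_real//.
by rewrite -addrA [X in _ <= _ + X]addrC addrA lerDl mulrn_wge0// mulr_ge0.
Qed.

Lemma normcX z k : nc (z ^+ k) = nc z ^+ k.
Proof.
elim: k => [|k IH]; first by rewrite !expr0 ComplexField.Normc.normc1.
by rewrite !exprS ComplexField.Normc.normcM IH.
Qed.

Lemma normc_prod (I : Type) (r : seq I) (P : pred I) (F : I -> R[i]) :
  nc (\prod_(i <- r | P i) F i) = \prod_(i <- r | P i) nc (F i).
Proof.
exact: (big_morph _ (@ComplexField.Normc.normcM R) (@ComplexField.Normc.normc1 R)).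
Qed.

(** The left-hand side is the real part of z e ^ (- iy). *)
Lemma trig_le_normc z y : complex.Re z * cos y + complex.Im z * sin y <= nc z.
Proof.
case: z => a b /=; apply: le_trans (ler_norm _) _; rewrite -sqrtr_sqr ler_wsqrtr//.
have := cos2Dsin2 y; move: (cos y) (sin y) => c s cs1.
have -> : a ^+ 2 + b ^+ 2 = (a * c + b * s) ^+ 2 + (a * s - b * c) ^+ 2.
  by rewrite -[LHS]mulr1 -cs1; ring.
by rewrite lerDl sqr_ge0.
Qed.

Lemma cexpD z w : cexp (z + w) = cexp z * cexp w.
Proof.
case: z w => [a b] [c d]; rewrite /cexp/= expRD cosD sinD; apply/eqP.
by rewrite eq_complex /=; apply/andP; split; apply/eqP; ring.
Qed.

Lemma cexp0 : cexp (0 : R[i]) = 1.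
Proof. by rewrite /cexp/= expR0 cos0 sin0 mul1r. Qed.

Lemma cexpMn z k : cexp (k%:R * z) = cexp z ^+ k.
Proof.
elim: k => [|k IH]; first by rewrite mul0r cexp0.
by rewrite -natr1 mulrDl mul1r cexpD IH exprSr.
Qed.

Lemma cexpN z : cexp (- z) = (cexp z)^-1.
Proof.
have h : cexp (- z) * cexp z = 1 by rewrite -cexpD addNr cexp0.
have z0 : cexp z != 0.
  by apply: contra_eqN h => /eqP ->; rewrite mulr0 eq_sym oner_eq0.
by rewrite -[LHS]mulr1 -(divff z0) mulrA h mul1r.
Qed.

Lemma clog_real t : 0 < t -> clog t%:C = (ln t)%:C.
Proof.
move=> t0; rewrite /clog /carg !normc_real !gtr0_norm// -[complex.Re _]/t -[complex.Im _]/(0 : R).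
by rewrite lexx divff ?gt_eqF// acos1.
Qed.

(** In the right half-plane the argument that [carg] builds from acos and a sign is an arctangent:
    both have the same cosine and the sign of the imaginary part. *)
Lemma clogE z : 0 < complex.Re z ->
  clog z = (ln (complex.Re z ^+ 2 + complex.Im z ^+ 2) / 2)
    +i* atan (complex.Im z / complex.Re z).
Proof.
case: z => p q /= p0.
have D0 : 0 < p ^+ 2 + q ^+ 2 by rewrite ltr_wpDr ?sqr_ge0// exprn_gt0.
rewrite /clog /carg/=; congr (_ +i* _).
  by rewrite -powR12_sqrt ?(ltW D0)// ln_powR mulrC.
have -> : p / Num.sqrt (p ^+ 2 + q ^+ 2) = cos (atan (q / p)).
  rewrite cos_atan (_ : p ^+ 2 + q ^+ 2 = p ^+ 2 * (1 + (q / p) ^+ 2)); last first.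
    by field; rewrite gt_eqF.
  rewrite sqrtrM ?sqr_ge0// sqrtr_sqr gtr0_norm// invfM mulrA divff ?mul1r//.
  by rewrite gt_eqF.
have [q0|q0] := leP 0 q.
  rewrite cosK// in_itv/= -[X in X <= _ <= _](@atan0 R) le_atan ?divr_ge0 ?(ltW p0)//=.
  have := atan_ltpi2 (q / p); have := @pi_gt0 R; lra.
rewrite cosKN ?opprK//; apply/andP; split.
  have := atan_gtNpi2 (q / p); have := @pi_gt0 R; lra.
by rewrite -[leRHS](@atan0 R) le_atan// ler_pdivrMr// mul0r ltW.
Qed.

Lemma cexp_clog z : 0 < complex.Re z -> cexp (clog z) = z.
Proof.
move=> z0; rewrite clogE//; case: z z0 => p q /= p0; rewrite /cexp/=.
have D0 : 0 < p ^+ 2 + q ^+ 2 by rewrite ltr_wpDr ?sqr_ge0// exprn_gt0.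
have Dq : Num.sqrt (p ^+ 2 + q ^+ 2) = p * Num.sqrt (1 + (q / p) ^+ 2).
  rewrite (_ : p ^+ 2 + q ^+ 2 = p ^+ 2 * (1 + (q / p) ^+ 2)); last first.
    by field; rewrite gt_eqF.
  by rewrite sqrtrM ?sqr_ge0// sqrtr_sqr gtr0_norm.
have s0 : Num.sqrt (1 + (q / p) ^+ 2) != 0.
  by rewrite gt_eqF// sqrtr_gt0 ltr_wpDr ?sqr_ge0.
have c0 : cos (atan (q / p)) != 0 by rewrite cos_atan invr_eq0.
have -> : sin (atan (q / p)) = q / p * cos (atan (q / p)).
  transitivity (tan (atan (q / p)) * cos (atan (q / p))); last by rewrite atanK.
  by rewrite /tan divfK.
have -> : expR (ln (p ^+ 2 + q ^+ 2) / 2) = p * Num.sqrt (1 + (q / p) ^+ 2).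
  rewrite -Dq -powR12_sqrt ?(ltW D0)// /powR gt_eqF// mulrC//.
rewrite cos_atan; apply/eqP; rewrite eq_complex/=.
apply/andP; split; apply/eqP; field; rewrite ?s0 ?gt_eqF//.
Qed.

Lemma cpow_real t z : 0 < t ->
  cpow t%:C z = (expR (complex.Re z * ln t))%:C
     * (cos (complex.Im z * ln t) +i* sin (complex.Im z * ln t)).
Proof.
move=> t0; rewrite /cpow ifF; last first.
  by apply/negbTE; rewrite eq_complex/= negb_and gt_eqF.
rewrite clog_real// /cexp; case: z => a b /=.
by rewrite !mulr0 subr0 add0r.
Qed.

End ComplexElementary.

(** * Modulus of the complex Gamma function *)

Section ComplexGamma.
Context {R : realType}.
Local Notation mu := (@lebesgue_measure R).
Implicit Types (a c x y t : R) (z w : R[i]).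
Local Notation nc := (@ComplexField.Normc.normc R).

Lemma GammaE z : 1 <= complex.Re z ->
  Gamma z = gammaI (complex.Re z - 1) (complex.Im z) 1 0
            +i* gammaI (complex.Re z - 1) (complex.Im z) 0 1.
Proof.
move=> z1; have a0 : 0 <= complex.Re z - 1 by rewrite subr_ge0.
rewrite /Gamma.
have -> : Num.truncn (1 - complex.Re z) = 0%N.
  by apply/truncn0Pn; rewrite -ltNge; lra.
rewrite big_ord0 divr1 addr0 /Gamma_integral /cintegral.
have E A B : \int[mu]_(t in `]0, +oo[) (t `^ (complex.Re z - 1) * expR (- t) *
      trig A B (complex.Im z * ln t)) = gammaI (complex.Re z - 1) (complex.Im z) A B.
  apply: Rintegral_itv_obnd_cbnd.
  apply: (integrableS _ _ _ (integrable_gammaI (complex.Im z) A B a0)) => //.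
  by move=> t /=; rewrite !in_itv/= !andbT; exact: ltW.
have Ep t : 0 < t -> cpow t%:C (z - 1) * (expR (- t))%:C =
   (t `^ (complex.Re z - 1) * expR (- t) * trig 1 0 (complex.Im z * ln t)) +i*
   (t `^ (complex.Re z - 1) * expR (- t) * trig 0 1 (complex.Im z * ln t)).
  move=> t0; rewrite cpow_real// ReD ImD ReN ImN /= oppr0 addr0 /trig /powR gt_eqF//.
  by apply/eqP; rewrite eq_complex/=; apply/andP; split; apply/eqP; ring.
rewrite -!E; congr (_ +i* _); apply: eq_Rintegral => t /set_mem/=;
  by rewrite in_itv/= andbT => t0; rewrite Ep.
Qed.

Lemma normc_Gamma_le z : 1 <= complex.Re z ->
  nc (Gamma z) <= 2 * rgamma (complex.Re z - 1).
Proof.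
move=> z1; have a0 : 0 <= complex.Re z - 1 by rewrite subr_ge0.
rewrite (le_trans (normc_le_Re_Im _))// GammaE//=.
have := normr_gammaI (complex.Im z) 1 0 a0.
have := normr_gammaI (complex.Im z) 0 1 a0.
rewrite normr0 normr1; lra.
Qed.

(** With a = Re z - 1 and q = Im z, the modulus dominates the real part of a ^ (- iq) Gamma z, and q
    ^ 2 <= a makes the factor 1 - q ^ 2 / (2 a) at least 1 / 2. *)
Lemma normc_Gamma_ge z : 2 <= complex.Re z -> complex.Im z ^+ 2 <= complex.Re z - 1 ->
  rgamma (complex.Re z - 1) / 2 <= nc (Gamma z).
Proof.
move=> z2 q2; have a1 : 1 <= complex.Re z - 1 by lra.
have a0 : 0 < complex.Re z - 1 by lra.
have g0 := rgamma_gt0 (ltW a0).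
apply: le_trans (trig_le_normc _ (complex.Im z * ln (complex.Re z - 1))).
have := gammaI_ge (complex.Im z) a1.
rewrite gammaIE ?(ltW a0)// GammaE; last by lra.
rewrite /= [cos _ * _]mulrC [sin _ * _]mulrC.
apply: le_trans; rewrite ler_pM2l//.
rewrite -subr_ge0 (_ : _ - _ = 2^-1 * (1 - complex.Im z ^+ 2 / (complex.Re z - 1))).
  by rewrite mulr_ge0// subr_ge0 ler_pdivrMr// mul1r.
by field; rewrite gt_eqF.
Qed.

Lemma Gamma_real a : 0 <= a -> Gamma (a%:C + 1) = (rgamma a)%:C.
Proof.
move=> a0; have e : complex.Re (a%:C + 1) - 1 = a by rewrite ReD/= addrK.
rewrite GammaE; last by rewrite ReD/=; lra.
rewrite e ImD/= addr0; congr (_ +i* _).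
  by rewrite /gammaI rgammaE; apply: eq_Rintegral => t _; rewrite /trig mul0r cos0 sin0; ring.
rewrite /gammaI -[RHS](_ : \int[mu]_(x in `[0, +oo[) 0 = 0); last by rewrite Rintegral_cst// mul0r.
by apply: eq_Rintegral => t _; rewrite /trig !mul0r sin0; ring.
Qed.

Lemma rGammaE z : 0 < complex.Re z -> rGamma z = (Gamma z)^-1.
Proof.
move=> z0; rewrite /rGamma asboolF// => -[k zk].
move: z0; rewrite zk ReN natC/= oppr_gt0 ltNge ler0n//.
Qed.

Lemma normc_rGamma_le z : 2 <= complex.Re z -> complex.Im z ^+ 2 <= complex.Re z - 1 ->
  nc (rGamma z) <= 2 / rgamma (complex.Re z - 1).
Proof.
move=> z2 q2; have g0 : 0 < rgamma (complex.Re z - 1) by apply: rgamma_gt0; lra.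
have h := normc_Gamma_ge z2 q2.
rewrite rGammaE; last by lra.
rewrite ComplexField.Normc.normcV -[leRHS]invrK lef_pV2 ?posrE ?invf_div//.
  by rewrite (lt_le_trans _ h)// divr_gt0.
by rewrite divr_gt0.
Qed.

Lemma Gamma_ratio_small q c e : 0 < c -> 0 < e ->
  exists X, forall z, complex.Im z = q -> X <= complex.Re z ->
    nc (Gamma z * rGamma (z + c%:C)) <= e.
Proof.
(* The ratio is at most 8 / M ^ c: one factor 2 from the upper bound on Gamma, one from the lower
   bound, one from 1 - M / (Re z - 1) >= 1 / 2. *)
move=> c0 e0; pose M := (8 / e) `^ c^-1.
have M0 : 0 < M by rewrite powR_gt0// divr_gt0.
have Mc : M `^ c = 8 / e.
  by rewrite -powRrM mulVf ?gt_eqF// powRr1// ltW// divr_gt0.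
clearbody M; exists (2 + q ^+ 2 + 2 * M) => z zq zX; have q0 := sqr_ge0 q.
have a1 : 1 <= complex.Re z - 1 by lra.
have a0 : 0 < complex.Re z - 1 by lra.
have g0 := rgamma_gt0 (ltW a0).
have h1 := @normc_Gamma_le z.
have h2 := @normc_rGamma_le (z + c%:C).
rewrite ReD ImD/= zq addr0 addrAC in h2.
have h3 := rgammaD_ge a1 (ltW c0) M0.
rewrite ComplexField.Normc.normcM.
apply: le_trans (ler_pM (normc_ge0 _) (normc_ge0 _) (h1 _) (h2 _ _)) _;
  [clear -a1; lra|clear -zX q0 M0 c0; lra|clear -zX q0 M0 c0; lra|].
have gc0 : 0 < rgamma (complex.Re z - 1 + c).
  by apply: rgamma_gt0; clear -a0 c0; lra.
rewrite mulrA ler_pdivrMr//.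
rewrite -(ler_pdivrMl _ _ e0); apply: le_trans h3.
rewrite Mc.
have : 2^-1 <= 1 - M / (complex.Re z - 1).
  clear -a0 zX q0.
  suff : M / (complex.Re z - 1) <= 2^-1 by lra.
  by rewrite ler_pdivrMr//; lra.
move=> /(ler_wpM2l (ltW g0)) /(ler_wpM2l (_ : 0 <= 8 / e)).
rewrite divr_ge0 ?(ltW e0)// => /(_ isT); apply: le_trans.
rewrite le_eqVlt; apply/orP; left; apply/eqP; field.
by rewrite gt_eqF.
Qed.

(** Gamma (x + 1) is compared with Gamma (x + Re b), at distance p = Re b - 1. For p <= 0 the
    quotient grows polynomially by [rgammaD_le]; for p > 0 it is at most 2 by [rgammaD_ge] with M =
    1. The sign of x + d is recorded for the later exponential bound on the power. *)
Lemma Gamma_ratio_poly (b : R[i]) : exists X d (N : nat), forall x, X <= x ->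
  nc (Gamma (x%:C + 1) * rGamma (x%:C + b)) <= 4 * (1 + (x + d) ^+ N) /\ 0 <= x + d.
Proof.
pose p := complex.Re b - 1; pose q := complex.Im b.
pose N := (Num.truncn `|p|).+1.
have /andP[pN1 pN2] : - N%:R <= p <= N%:R by rewrite -ler_norml ltW// truncnS_gt.
have pE : complex.Re b - 1 = p by [].
clearbody p N; have [pp1 pp2] : - `|p| <= p /\ p <= `|p| by apply/andP; rewrite -ler_norml.
exists (2 + `|p| + q ^+ 2), (p + N%:R), N => x xX; have q0 := sqr_ge0 q.
have p0 := normr_ge0 p.
have x0 : 0 <= x by lra.
have a1 : 1 <= x + p by lra.
have a0 : 0 <= x + p by lra.
have ga0 := rgamma_gt0 a0.
split; last by lra.
have P0 : 0 <= (x + (p + N%:R)) ^+ N by rewrite exprn_ge0//; lra.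
have gx : rgamma x <= 2 * (1 + (x + (p + N%:R)) ^+ N) * rgamma (x + p).
  have [pn|pp] := leP p 0.
    have := @rgammaD_le _ (x + p) (- p) N a0; rewrite addrK => /(_ _) h.
    apply: le_trans (h _) _; first by clear -pn pN1; lra.
    rewrite -addrA; apply: (ler_wpM2r (ltW ga0)); clear -P0; lra.
  have := @rgammaD_ge _ x p 1 _ (ltW pp) ltr01; rewrite powR1 mul1r => h.
  have x2 : 2 <= x by clear -xX q0 p0; lra.
  have {h}h : rgamma x * (1 - 1 / x) <= rgamma (x + p) by apply: h; clear -x2; lra.
  have : 2^-1 <= 1 - 1 / x.
    clear -x2; suff : 1 / x <= 2^-1 by lra.
    by rewrite ler_pdivrMr; lra.
  move=> /(ler_wpM2l (ltW (rgamma_gt0 x0))) h2.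
  have : rgamma x <= 2 * rgamma (x + p).
    by move: h h2; move: (rgamma x) (rgamma (x + p)) (1 / x) => u v w; clear; lra.
  move=> /le_trans; apply; apply: (ler_wpM2r (ltW ga0)); clear -P0; lra.
have h := @normc_rGamma_le (x%:C + b).
have e : complex.Re (x%:C + b) - 1 = x + p by rewrite ReD/= -pE addrA.
rewrite e ImD/= add0r -/q in h.
rewrite ComplexField.Normc.normcM Gamma_real// normc_real ger0_norm ?(ltW (rgamma_gt0 x0))//.
apply: le_trans (ler_pM (ltW (rgamma_gt0 x0)) (normc_ge0 _) gx (h _ _)) _; 
  [rewrite ReD/=; clear -xX q0 p0 pp1 pE; lra|clear -xX q0 p0 pp1; lra|].
rewrite le_eqVlt; apply/orP; left; apply/eqP; field.
by rewrite gt_eqF.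
Qed.

End ComplexGamma.

(** * Decay of the coefficients *)

Section Geometric.
Context {R : realType}.
Implicit Types (u v w : nat -> R).

Lemma geometric_of_eventually u K (B D : R) : 0 < D ->
  (forall k, (K <= k)%N -> u k <= B * D ^+ k) ->
  exists2 C, 0 <= C & forall k, u k <= C * D ^+ k.
Proof.
move=> D0 uB; exists (`|B| + \sum_(i < K) `|u i| / D ^+ i).
  by rewrite addr_ge0// sumr_ge0// => i _; rewrite divr_ge0// exprn_ge0// ltW.
move=> k; have Dk : 0 < D ^+ k by rewrite exprn_gt0.
have S0 : 0 <= \sum_(i < K) `|u i| / D ^+ i.
  by rewrite sumr_ge0// => i _; rewrite divr_ge0// exprn_ge0// ltW.
have [Kk|kK] := leqP K k.
  apply: le_trans (uB _ Kk) _; rewrite ler_wpM2r ?(ltW Dk)//.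
  by rewrite (le_trans (ler_norm _))// lerDl.
rewrite -ler_pdivrMr// (bigD1 (Ordinal kK))//= addrCA.
rewrite (@le_trans _ _ (`|u k| / D ^+ k))// ?ler_wpM2r ?ler_norm ?invr_ge0 ?(ltW Dk)//.
by rewrite lerDl addr_ge0// sumr_ge0// => i _; rewrite divr_ge0// exprn_ge0// ltW.
Qed.

Lemma geometric_of_ratio v (e : R) K : 0 < e -> (forall k, 0 <= v k) ->
  (forall k, (K <= k)%N -> v k.+1 <= e * v k) ->
  exists2 C, 0 <= C & forall k, v k <= C * e ^+ k.
Proof.
move=> e0 v0 ve; apply: (@geometric_of_eventually v K (v K / e ^+ K)) => // k.
elim: k => [|k IH].
  by rewrite leqn0 => /eqP ->; rewrite expr0 divr1 mulr1.
rewrite leq_eqVlt => /predU1P[<-|Kk].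
  by rewrite divfK// expf_neq0// gt_eqF.
apply: le_trans (ve _ Kk) _; rewrite exprS mulrCA ler_wpM2l ?(ltW e0)//.
exact: IH.
Qed.

Lemma geometric_mul v w K (B D : R) : (forall k, 0 <= v k) -> (forall k, 0 <= w k) ->
  (forall e, 0 < e -> exists K, forall k, (K <= k)%N -> v k.+1 <= e * v k) ->
  0 < D -> (forall k, (K <= k)%N -> w k <= B * D ^+ k) ->
  forall r, 0 <= r -> exists2 C, 0 <= C & forall k, v k * w k * r ^+ k <= C * 2^-1 ^+ k.
Proof.
move=> v0 w0 ve D0 wB r r0.
have [C1 C10 wC] := geometric_of_eventually D0 wB.
(* Chosen so that e D (r + 1) = 1 / 2; r + 1 replaces r because r may be 0. *)
have e0 : 0 < (2 * D * (r + 1))^-1 by rewrite invr_gt0 !mulr_gt0// ltr_wpDl.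
have [K1 vK] := ve _ e0.
have [C2 C20 vC] := geometric_of_ratio e0 v0 vK.
exists (C2 * C1); first exact: mulr_ge0.
move=> k.
have rk : r ^+ k <= (r + 1) ^+ k by rewrite lerXn2r ?nnegrE; lra.
apply: le_trans (ler_pM _ _ (ler_pM (v0 k) (w0 k) (vC k) (wC k)) rk) _.
- exact: mulr_ge0.
- exact: exprn_ge0.
rewrite le_eqVlt; apply/orP; left; apply/eqP.
rewrite mulrACA -!mulrA -!exprMn; congr (_ * (_ * _ ^+ _)).
field; rewrite !gt_eqF//; lra.
Qed.

End Geometric.

Section Coefficients.
Variables (R : realType) (n : nat).
Variables (alpha : 'I_n.+1 -> R) (nu : 'I_n -> R[i]).
Hypothesis hn : (1 <= n)%N.
Hypothesis halpha : forall j, 0 < alpha j.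
Local Notation nc := (@ComplexField.Normc.normc R).
Local Notation al := (alast alpha).

Lemma WbE j : Wb alpha nu j = Wa alpha nu j + (index1 alpha j)%:C.
Proof.
rewrite /Wb /Wa -addrA; congr (1 + _).
elim: j => [|j IH]; first by rewrite !big_geq//= addr0.
rewrite big_nat_recr//= IH [in RHS]big_nat_recr//=.
ring.
Qed.

Lemma index1_alpha_gt0 j : (1 <= j <= n)%N -> 0 < index1 alpha j.
Proof.
case: j => [|j]//= jn; rewrite insubT ?ltnS ?(ltnW jn)// => h.
exact: halpha.
Qed.

Let factor j k := nc (Gamma (al%:C * k%:R + Wa alpha nu j)
                      * rGamma (al%:C * k%:R + Wb alpha nu j)).

Lemma Re_alM k (b : R[i]) : complex.Re (al%:C * k%:R + b) = al * k%:R + complex.Re b.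
Proof. by rewrite ReD natC -rmorphM. Qed.

Lemma Im_alM k (b : R[i]) : complex.Im (al%:C * k%:R + b) = complex.Im b.
Proof. by rewrite ImD natC -rmorphM/= add0r. Qed.

Lemma al_large (X b : R) : exists K, forall k, (K <= k)%N -> X <= al * k%:R + b.
Proof.
have a0 : 0 < al by exact: halpha.
exists (Num.truncn ((X - b) / al)).+1 => k Kk.
rewrite -lerBlDr mulrC -ler_pdivrMr//.
by rewrite (le_trans (ltW (truncnS_gt _)))// ler_nat.
Qed.

Lemma factor_small e j : 0 < e -> (1 <= j <= n)%N ->
  exists K, forall k, (K <= k)%N -> factor j k <= e.
Proof.
move=> e0 jn.
have [X hX] := @Gamma_ratio_small _ (complex.Im (Wa alpha nu j)) _ _ (index1_alpha_gt0 jn) e0.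
have [K hK] := al_large X (complex.Re (Wa alpha nu j)).
exists K => k Kk; rewrite /factor WbE (addrA _ (Wa _ _ _)); apply: hX; first exact: Im_alM.
by rewrite Re_alM; exact: hK.
Qed.

Lemma Wprod_ratio e : 0 < e ->
  exists K, forall k, (K <= k)%N -> nc (Wprod alpha nu k.+1) <= e * nc (Wprod alpha nu k).
Proof.
(* The ratio is a product of n >= 1 factors: the factor j = 1 supplies e, the others need only be at
   most 1. *)
move=> e0; pose e1 := Num.min e 1.
have e10 : 0 < e1 by rewrite lt_min e0 ltr01.
have H m : (m <= n)%N -> exists K, forall k j, (K <= k)%N -> (1 <= j <= m)%N -> factor j k <= e1.
  elim: m => [|m IH] mn; first by exists 0%N => k [|j].
  have [K1 h1] := IH (ltnW mn).
  have [K2 h2] := @factor_small e1 m.+1 e10 mn.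
  exists (maxn K1 K2) => k j; rewrite geq_max => /andP[k1 k2] /andP[j1].
  rewrite leq_eqVlt => /predU1P[->|jm]; first exact: h2.
  by apply: h1; rewrite ?j1.
have [K hK] := H n (leqnn n).
exists K => k Kk; rewrite /Wprod big_nat_recr//= ComplexField.Normc.normcM mulrC.
rewrite ler_wpM2r ?normc_ge0// normc_prod.
have Kk1 : (K <= k.+1)%N by exact: leqW.
rewrite big_ltn// (@le_trans _ _ (e1 * 1)) ?mulr1 ?ge_min ?lexx//.
rewrite -[leRHS]mulr1 ler_pM ?normc_ge0//.
- by apply: prodr_ge0 => i _; exact: normc_ge0.
- by apply: hK.
rewrite big_seq; apply: prodr_ile1 => i; rewrite mem_index_iota => /andP[i1 i2].
rewrite normc_ge0/= (@le_trans _ _ e1) ?ge_min ?lexx ?orbT//.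
by apply: hK => //; rewrite (ltnW i1)/= -ltnS.
Qed.

(** The ratios of the products tend to 0, while the Gamma quotient grows polynomially in k, hence at
    most like e ^ (alpha_{n+1} k); [geometric_mul] combines the two. *)
Lemma Wprod_Gamma_bound (b : R[i]) r : 0 <= r -> exists2 C, 0 <= C & forall k,
  nc (Wprod alpha nu k) * nc (Gamma (al%:C * k%:R + 1) * rGamma (al%:C * k%:R + b))
    * r ^+ k <= C * 2^-1 ^+ k.
Proof.
have a0 : 0 < al by exact: halpha.
have [X [d [N hX]]] := Gamma_ratio_poly b.
have [K hK] := al_large X 0.
have [C C0 hC] := @powR_le_expR R N%:R 1 (ler0n _ _) ltr01.
apply: (@geometric_mul _ (fun k => nc (Wprod alpha nu k))
  (fun k => nc (Gamma (al%:C * k%:R + 1) * rGamma (al%:C * k%:R + b))) K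
  (4 * (1 + C * expR d)) (expR al)).
- by move=> k; exact: normc_ge0.
- by move=> k; exact: normc_ge0.
- exact: Wprod_ratio.
- exact: expR_gt0.
move=> k Kk; have := hX (al * k%:R); have := hK _ Kk; rewrite addr0 => hk /(_ hk).
have -> : (al * k%:R)%:C = al%:C * k%:R by rewrite natC -rmorphM.
move=> -[+ h0]; move=> /le_trans; apply.
rewrite -mulrA ler_pM2l// mulrDl mul1r lerD//.
  by rewrite -expRM_natr -[leLHS]expR0 ler_expR mulr_ge0// ltW.
have := hC _ h0; rewrite powR_mulrn// mul1r expRD mulrA [_ * expR d]mulrC => h.
by rewrite -expRM_natr (le_trans h)// mulrCA mulrA.
Qed.

End Coefficients.

(** * Termwise integration *)

Section ComplexSeries.
Context {R : realType}.
Implicit Types (u : nat -> R[i]).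
Local Notation nc := (@ComplexField.Normc.normc R).

Lemma Re_series u k : complex.Re (series (u : nat -> R[i]^o) k) = series (fun i => complex.Re (u i)) k.
Proof. by rewrite /series/=; apply: (big_morph (@complex.Re R)) => // z w; exact: ReD. Qed.

Lemma Im_series u k : complex.Im (series (u : nat -> R[i]^o) k) = series (fun i => complex.Im (u i)) k.
Proof. by rewrite /series/=; apply: (big_morph (@complex.Im R)) => // z w; exact: ImD. Qed.

Lemma cvg_complex_series u (a b : R) :
  series (fun k => complex.Re (u k)) @ \oo --> a ->
  series (fun k => complex.Im (u k)) @ \oo --> b ->
  series (u : nat -> R[i]^o) @ \oo --> (a +i* b : R[i]^o).
Proof.
move=> ha hb; apply/cvgrPdist_lt => e.
(* The norm of [R[i]^o] takes values in [R[i]], whose order makes a positive [e] a real number. *)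
rewrite ltcE/= => /andP[/eqP ei e0].
have e20 : 0 < complex.Re e / 2 by rewrite divr_gt0.
move/cvgrPdist_lt : ha => /(_ _ e20) ha; move/cvgrPdist_lt : hb => /(_ _ e20) hb.
near=> k.
have -> : `|(a +i* b : R[i]^o) - series (u : nat -> R[i]^o) k| =
    (nc (a +i* b - series (u : nat -> R[i]^o) k))%:C.
  by [].

rewrite ltcE/= ei eqxx/=.
apply: le_lt_trans (normc_le_Re_Im _) _.
rewrite ReD ImD ReN ImN/= Re_series Im_series [ltRHS](splitr (complex.Re e)).
by apply: ltrD; near: k.
Unshelve. all: by end_near. Qed.

Lemma cvgn_series_geometric (v : nat -> R) C :
  (forall k, `|v k| <= C * 2^-1 ^+ k) -> cvgn (series v).
Proof.
move=> vC; apply: normed_cvg.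
have C0 : 0 <= C by have := le_trans (normr_ge0 _) (vC 0%N); rewrite mulr1.
apply: (@series_le_cvg _ _ (geometric C 2^-1)) => //=.
- by move=> k; rewrite /geometric/= mulr_ge0// exprn_ge0.
- by apply: is_cvg_geometric_series; rewrite ger0_norm//; lra.
Qed.

Lemma csum_geometric u C : (forall k, nc (u k) <= C * 2^-1 ^+ k) ->
  [/\ csummable u,
      series (fun k => complex.Re (u k)) @ \oo --> complex.Re (csum u) &
      series (fun k => complex.Im (u k)) @ \oo --> complex.Im (csum u)].
Proof.
move=> uC.
have cr : cvgn (series (fun k => complex.Re (u k))).
  by apply: (@cvgn_series_geometric _ C) => k; exact: le_trans (normr_Re_le _) _.
have ci : cvgn (series (fun k => complex.Im (u k))).
  by apply: (@cvgn_series_geometric _ C) => k; exact: le_trans (normr_Im_le _) _.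
have h := cvg_complex_series cr ci.
have e : csum u = limn (series (fun k => complex.Re (u k))) +i*
                  limn (series (fun k => complex.Im (u k))).
  have hd : hausdorff_space (R[i]^o : pseudoMetricNormedZmodType R[i]) by exact: norm_hausdorff.
  exact: (@cvg_lim _ hd _ _ _ _ _ h).
split; first by apply/cvg_ex; exists (limn (series (fun k => complex.Re (u k))) +i*
                  limn (series (fun k => complex.Im (u k)))).
- by rewrite e.
- by rewrite e.
Qed.

End ComplexSeries.

(** * Exchange of series and integral *)

Section Exchange.
Context {R : realType}.
Local Notation mu := (@lebesgue_measure R).
Local Notation D := (`[0, +oo[%classic : set R).

(** Dominated convergence for the partial sums. The dominating function is the extended-real sum of
    the [g k], whose integral is at most B by monotone convergence. *)
Lemma Rintegral_series_dominated (F g : nat -> R -> R) (f : R -> R) (B : R) :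
  (forall k, measurable_fun D (F k)) ->
  (forall k x, 0 <= g k x) ->
  (forall k, mu.-integrable D (EFin \o g k)) ->
  (forall k x, D x -> `|F k x| <= g k x) ->
  (forall k, \sum_(0 <= i < k) \int[mu]_(x in D) g i x <= B) ->
  (forall x, D x -> series (fun k => F k x) @ \oo --> f x) ->
  mu.-integrable D (EFin \o f) /\
  series (fun k => \int[mu]_(x in D) F k x) @ \oo --> \int[mu]_(x in D) f x.
Proof.
move=> mF g0 ig Fg gB Ff.
have iF k : mu.-integrable D (EFin \o F k).
  apply: (@le_integrable _ _ _ mu _ _ _ (EFin \o g k)) => //.
    by apply/measurable_EFinP; exact: mF.
  by move=> x Dx /=; rewrite lee_fin (le_trans (Fg k x Dx))// ler_norm.
pose G x := (\sum_(k <oo) (g k x)%:E)%E.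
have mg k : measurable_fun D (EFin \o g k) by exact: measurable_int (ig k).
have G0 x : (0 <= G x)%E by apply: nneseries_ge0 => k _ _; rewrite lee_fin.
have mG : measurable_fun D G.
  have h := @ge0_emeasurable_sum _ _ R D (fun k x => (g k x)%:E) xpredT.
  by apply: h => [k x _ _|k _]; [rewrite lee_fin|exact: mg].
have iG : mu.-integrable D G.
  apply/integrableP; split => //.
  under eq_integral do rewrite gee0_abs//.
  rewrite integral_nneseries//; last by move=> k x _; rewrite lee_fin.
  apply: (@le_lt_trans _ _ B%:E); last exact: ltry.
  apply: lime_le.
    by apply: is_cvg_nneseries => k _ _; apply: integral_ge0 => x _; rewrite lee_fin.
  apply: nearW => k.
  rewrite (eq_bigr (fun i => (\int[mu]_(x in D) g i x)%:E)); last first.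
    by move=> i _; rewrite /Rintegral fineK//; apply: integrable_fin_num => //; exact: ig.
  by rewrite sumEFin lee_fin.
pose f_ k x := (\sum_(0 <= i < k) F i x)%:E.
have mf_ k : measurable_fun D (f_ k).
  by apply/measurable_EFinP; apply: measurable_sum => i; exact: mF.
have f_cvg x : D x -> f_ ^~ x @ \oo --> (EFin \o f) x.
  by move=> Dx; apply: cvg_EFin; [exact: nearW|exact: Ff].
have f_f : {ae mu, forall x, D x -> f_ ^~ x @ \oo --> (EFin \o f) x} by exact: aeW.
have f_g : {ae mu, forall x k, D x -> (`|f_ k x| <= G x)%E}.
  apply: aeW => x k Dx; rewrite /f_ abse_EFin.
  apply: (@le_trans _ _ (\sum_(0 <= i < k) (g i x)%:E)%E).
    rewrite sumEFin lee_fin (le_trans (ler_norm_sum _ _ _))// ler_sum// => i _.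
    exact: Fg.
  by apply: nneseries_lim_ge => i _ _; rewrite lee_fin.
have mf' : measurable_fun D (EFin \o f) by exact: (emeasurable_fun_cvg _ _ mf_ f_cvg).
have [If _ cvgI] := @dominated_convergence _ _ _ mu D (measurable_itv _) f_ (EFin \o f) G mf_ mf' f_f iG f_g.
split => //.
have E k : series (fun k => \int[mu]_(x in D) F k x) k = fine (\int[mu]_(x in D) f_ k x).
  rewrite /series/= /f_; under [in RHS]eq_integral do rewrite -sumEFin.
  rewrite integral_sum//.
  rewrite (eq_bigr (fun i => (\int[mu]_(x in D) F i x)%:E)) ?sumEFin//.
  by move=> i _; rewrite /Rintegral fineK//; apply: integrable_fin_num => //; exact: iF.
rewrite (eq_cvg _ _ E); apply: fine_cvg.
by rewrite fineK//; exact: integrable_fin_num.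
Qed.

End Exchange.

Section Termwise.
Variables (R : realType) (n : nat).
Variables (alpha : 'I_n.+1 -> R) (nu : 'I_n -> R[i]).
Hypothesis hn : (1 <= n)%N.
Hypothesis halpha : forall j, 0 < alpha j.
Local Notation mu := (@lebesgue_measure R).
Local Notation D := (`[0, +oo[%classic : set R).
Local Notation nc := (@ComplexField.Normc.normc R).
Local Notation al := (alast alpha).
Local Notation bl := (Wb alpha nu n.+1).

(** [rgammaD_ge] at a = 2 and M = 1 gives Gamma (3) (1 - 1 / 2) = 1. *)
Lemma rgamma_ge1 (x : R) : 2 <= x -> 1 <= rgamma x.
Proof.
move=> x2; have := @rgammaD_ge R 2 (x - 2) 1.
have -> : rgamma (2 : R) = 2.
  have -> : (2 : R) = 0 + 1 + 1 by lra.
  by rewrite !rgammaS ?addr_ge0// rgamma0; lra.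
rewrite powR1 subrKC mul1r => /(_ _ _ ltr01) h; have := h _ _; lra.
Qed.

Lemma Gamma_alM k : Gamma (al%:C * k%:R + 1) = (rgamma (al * k%:R))%:C.
Proof.
have -> : al%:C * k%:R = (al * k%:R)%:C by rewrite natC -rmorphM.
by rewrite Gamma_real// mulr_ge0// ltW// halpha.
Qed.

(** For large k, Gamma (alpha_{n+1} k + 1) >= 1, so multiplying by it does not decrease the modulus
    of the term and [Wprod_Gamma_bound] applies. *)
Lemma Wterm_bound z : exists C, forall k, nc (Wterm alpha nu z k) <= C * 2^-1 ^+ k.
Proof.
have [C C0 hC] := Wprod_Gamma_bound nu hn halpha bl (normc_ge0 z).
have [K hK] := al_large halpha 2 0.
have h20 : (0 : R) < 2^-1 by lra.
have [|C' _ hC'] := @geometric_of_eventually _ (fun k => nc (Wterm alpha nu z k)) K C 2^-1 h20.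
  move=> k Kk; apply: le_trans (hC k).
  rewrite /Wterm Gamma_alM !ComplexField.Normc.normcM normcX normc_real.
  have g1 : 1 <= `|rgamma (al * k%:R)|.
    by rewrite (le_trans _ (ler_norm _))// rgamma_ge1//; have := hK _ Kk; lra.
  rewrite -!mulrA ler_wpM2l ?normc_ge0// mulrC -[leLHS]mul1r.
  by rewrite ler_wpM2r ?mulr_ge0 ?normc_ge0 ?exprn_ge0 ?normc_ge0.
by exists C'.
Qed.

End Termwise.

(** * Real and imaginary parts of the terms *)

Section Components.
Context {R : realType}.
Local Notation mu := (@lebesgue_measure R).
Local Notation D := (`[0, +oo[%classic : set R).
Local Notation nc := (@ComplexField.Normc.normc R).
Implicit Types (u : nat -> R[i]) (c d s z w : R[i]).

Lemma ReM z w : complex.Re (z * w) =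
  complex.Re z * complex.Re w - complex.Im z * complex.Im w.
Proof. by case: z w => [a b] [x y]. Qed.

Lemma ImM z w : complex.Im (z * w) =
  complex.Re z * complex.Im w + complex.Im z * complex.Re w.
Proof. by case: z w => [a b] [x y]. Qed.

Lemma csum_geometricM u C c : (forall k, nc (u k) <= C * 2^-1 ^+ k) ->
  series (fun k => complex.Re (c * u k)) @ \oo --> complex.Re (c * csum u) /\
  series (fun k => complex.Im (c * u k)) @ \oo --> complex.Im (c * csum u).
Proof.
move=> uC; have [_ hr hi] := csum_geometric uC.
rewrite ReM ImM; split.
- have e : series (fun k => complex.Re (c * u k)) =
     (fun k => complex.Re c * series (fun k => complex.Re (u k)) k
             - complex.Im c * series (fun k => complex.Im (u k)) k).
    apply/funext => k; rewrite /series/= !mulr_sumr -sumrB.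
    by apply: eq_bigr => i _; exact: ReM.
  by rewrite e; apply: cvgB; apply: cvgM => //; exact: cvg_cst.
- have e : series (fun k => complex.Im (c * u k)) =
     (fun k => complex.Re c * series (fun k => complex.Im (u k)) k
             + complex.Im c * series (fun k => complex.Re (u k)) k).
    apply/funext => k; rewrite /series/= !mulr_sumr -big_split.
    by apply: eq_bigr => i _; exact: ImM.
  by rewrite e; apply: cvgD; apply: cvgM => //; exact: cvg_cst.
Qed.

(** For d = A + iB, d e ^ (- iy) has real part [trig A B y] and imaginary part [trig B (- A) y]. *)
Lemma cexp_laplaceK s d a (x : R) :
  cexp (- s * x%:C) * (d * (x `^ a)%:C) =
  laplaceK a (complex.Re s) (complex.Im s) (complex.Re d) (complex.Im d) x
  +i* laplaceK a (complex.Re s) (complex.Im s) (complex.Im d) (- complex.Re d) x.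
Proof.
case: s d => [p q] [A B]; rewrite /laplaceK /cexp /trig /=.
rewrite !mulr0 subr0 add0r !mulNr cosN sinN.
by apply/eqP; rewrite eq_complex/=; apply/andP; split; apply/eqP; ring.
Qed.

Lemma laplaceIE a (p q A B : R) : 0 <= a -> 0 < p ->
  laplaceI a p q A B = A * laplaceI a p q 1 0 + B * laplaceI a p q 0 1.
Proof.
move=> a0 p0; rewrite /laplaceI -!RintegralZl//; try exact: integrable_laplaceK.
rewrite -RintegralD//; try exact/integrableZ/integrable_laplaceK.
by apply: eq_Rintegral => x _; rewrite /laplaceK /trig; ring.
Qed.

(** The complex form of [laplaceI_eval]: d L(a, s) = d Gamma (a + 1) / s ^ (a + 1). *)
Lemma laplaceI_cexp s d a : 0 <= a -> 0 < complex.Re s ->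
  laplaceI a (complex.Re s) (complex.Im s) (complex.Re d) (complex.Im d)
  +i* laplaceI a (complex.Re s) (complex.Im s) (complex.Im d) (- complex.Re d)
  = d * (rgamma a)%:C * cexp (- ((a + 1)%:C * clog s)).
Proof.
move=> a0 s0; rewrite [laplaceI _ _ _ (complex.Re d) _]laplaceIE//.
rewrite [laplaceI _ _ _ (complex.Im d) _]laplaceIE//.
have [-> ->] := laplaceI_eval (complex.Im s) a0 s0.
rewrite clogE// /cexp/= -/(rgamma a).
case: d => [A B]/=; rewrite !mul0r !subr0 !addr0 cosN sinN -mulNr.
move: (rgamma a) (expR _) (cos _) (sin _) => g e co si.
apply/eqP; rewrite eq_complex/= !(mulr0, mul0r, subr0, add0r, addr0).
apply/andP; split; apply/eqP; first by ring.
ring.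
Qed.

(** All powers come from the single logarithm [clog s] and k is an integer, so no change of branch
    occurs. *)
Lemma cexp_clogMn s (a : R) k : 0 < complex.Re s ->
  cexp (- ((a * k%:R + 1)%:C * clog s)) = s^-1 * (cpow s a%:C) ^- k.
Proof.
move=> s0; have sn0 : s != 0.
  by apply: contraTneq s0 => ->; rewrite /= ltxx.
rewrite /cpow (negbTE sn0) -cexpMn -cexpN.
rewrite -[X in _ = X^-1 * _](cexp_clog s0) -cexpN -cexpD natC; congr cexp.
by rewrite rmorphD rmorphM; ring.
Qed.

Lemma sum_half_le k : \sum_(0 <= i < k) (2^-1 : R) ^+ i <= 2.
Proof.
suff : \sum_(0 <= i < k) (2^-1 : R) ^+ i + 2 * 2^-1 ^+ k = 2.
  have : 0 <= (2^-1 : R) ^+ k by rewrite exprn_ge0.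
  lra.
elim: k => [|k IH]; first by rewrite big_geq// add0r mulr1.
by rewrite big_nat_recr//= -[RHS]IH exprS; lra.
Qed.

End Components.

Theorem mainTheorem2 (R : realType) (n : nat) (hn : (1 <= n)%N)
    (alpha : 'I_n.+1 -> R) (nu : 'I_n -> R[i]) (lambda : R)
    (halpha : forall j, 0 < alpha j)
    (hpole : forall i j : nat, (1 <= i)%N -> (1 <= j <= n)%N ->
       ~ Gamma_pole ((alast alpha)%:C * i%:R + Wa alpha nu j))
    (s : R[i]) (hs : 0 < complex.Re s) :
  let f (x : R) :=
    cexp (- s * x%:C) * W alpha nu (lambda * x `^ alast alpha)%:C in
  let g (k : nat) :=
    Wprod alpha nu k
    * (Gamma ((alast alpha)%:C * k%:R + 1)
       * rGamma ((alast alpha)%:C * k%:R + Wb alpha nu n.+1))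
    * (lambda%:C / cpow s (alast alpha)%:C) ^+ k in
  [/\ forall z : R[i], csummable (Wterm alpha nu z),
      cintegrable `[0, +oo[ f,
      csummable g &
      cintegral `[0, +oo[ f = s^-1 * csum g].
Proof.
move=> f g.
set al := alast alpha in f g *; set bl := Wb alpha nu n.+1 in f g *.
have al0 : 0 < al by exact: halpha.
have alk k : 0 <= al * k%:R by rewrite mulr_ge0// ltW.
pose sg := complex.Re s; pose tau := complex.Im s.
pose nc := @ComplexField.Normc.normc R.
have gC : exists C, forall k, nc (g k) <= C * 2^-1 ^+ k.
  have [C _ hC] := Wprod_Gamma_bound nu hn halpha bl (normc_ge0 (lambda%:C / cpow s al%:C)).
  exists C => k; apply: le_trans (hC k).
  by rewrite -normcX -!ComplexField.Normc.normcM lexx.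
have [Cg hCg] := gC.
have [gS gRe gIm] := csum_geometric hCg.
(* Coefficient of x ^ (alpha_{n+1} k) in the integrand's series, with lambda ^ k absorbed. *)
pose d k := Wprod alpha nu k * (lambda%:C ^+ k * rGamma (al%:C * k%:R + bl)).
have WtermE x k : 0 <= x ->
    Wterm alpha nu (lambda * x `^ al)%:C k = d k * (x `^ (al * k%:R))%:C.
  move=> x0; rewrite /Wterm /d -/al -/bl powRrM powR_mulrn ?powR_ge0//.
  by rewrite rmorphM exprMn rmorphXn/=; ring.
pose FRe k x := laplaceK (al * k%:R) sg tau (complex.Re (d k)) (complex.Im (d k)) x.
pose FIm k x := laplaceK (al * k%:R) sg tau (complex.Im (d k)) (- complex.Re (d k)) x.
have fRI x : `[0, +oo[%classic x ->
    series (fun k => FRe k x) @ \oo --> complex.Re (f x) /\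
    series (fun k => FIm k x) @ \oo --> complex.Im (f x).
  rewrite /= in_itv/= andbT => x0.
  have [C hC] := Wterm_bound nu hn halpha (lambda * x `^ al)%:C.
  have [h1 h2] := csum_geometricM (cexp (- s * x%:C)) hC.
  have e k : cexp (- s * x%:C) * Wterm alpha nu (lambda * x `^ al)%:C k = FRe k x +i* FIm k x.
    by rewrite WtermE// cexp_laplaceK.
  split; [move: h1|move: h2]; rewrite /f /W /=; under eq_fun do rewrite e; exact.
have E k : (\int[@lebesgue_measure R]_(x in `[0, +oo[) FRe k x)
    +i* (\int[@lebesgue_measure R]_(x in `[0, +oo[) FIm k x) = s^-1 * g k.
  have := laplaceI_cexp (d k) (alk k) hs; rewrite /laplaceI -/sg -/tau => ->.
  rewrite cexp_clogMn// /g /d -/bl Gamma_alM// -/al exprMn exprVn; ring.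
have [Cd [Cd0 hCd]] : exists C, 0 <= C /\ forall k, 2 * nc (d k) * laplaceI (al * k%:R) sg 0 1 0 <= C * 2^-1 ^+ k.
  (* This is ln (Re s), in the form that [laplaceI_eval] yields at q = 0. The geometric rate to beat
     is thus |lambda| (Re s) ^ (- alpha_{n+1}). *)
  pose r := ln (sg ^+ 2 + 0 ^+ 2) / 2.
  have r0 : 0 <= `|lambda| * expR (- al * r) by rewrite mulr_ge0 ?expR_ge0.
  have [C C0 hC] := Wprod_Gamma_bound nu hn halpha bl r0.
  exists (2 * expR (- r) * C); split; first by rewrite !mulr_ge0 ?expR_ge0.
  move=> k; have [-> _] := @laplaceI_eval R (al * k%:R) sg 0 (alk k) hs.
  rewrite mul0r atan0 mulr0 cos0 mulr1 -/r -/(rgamma (al * k%:R)) -mulrA.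
  have := ler_wpM2l (_ : 0 <= 2 * expR (- r)) (hC k).
  rewrite mulr_ge0 ?expR_ge0// => /(_ isT); rewrite [leRHS]mulrA; apply: le_trans.
  rewrite le_eqVlt; apply/orP; left; apply/eqP.
  rewrite -/al Gamma_alM// -/al /d /nc !ComplexField.Normc.normcM normcX !normc_real.
  rewrite (ger0_norm (ltW (rgamma_gt0 (alk k)))) exprMn -expRM_natr.
  have -> : - (al * k%:R + 1) * r = - r + - al * r * k%:R by ring.
  by rewrite expRD; ring.
(* At the real point Re s the kernel no longer oscillates. The factor 2 bounds |A| + |B| for the
   components A, B of [d k] up to sign, so one majorant serves real and imaginary parts. *)
pose G k x := 2 * nc (d k) * laplaceK (al * k%:R) sg 0 1 0 x.
have GE k x : G k x = 2 * nc (d k) * (x `^ (al * k%:R) * expR (- sg * x)).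
  by rewrite /G /laplaceK /trig mul0r cos0 sin0; ring.
have G0 k x : 0 <= G k x by rewrite GE !mulr_ge0 ?normc_ge0 ?powR_ge0 ?expR_ge0.
have iG k : (@lebesgue_measure R).-integrable `[0, +oo[ (EFin \o G k).
  exact/integrableZ/integrable_laplaceK.
have SG k : \sum_(0 <= i < k) \int[@lebesgue_measure R]_(x in `[0, +oo[) G i x <= Cd * 2.
  apply: (@le_trans _ _ (\sum_(0 <= i < k) Cd * 2^-1 ^+ i)).
    apply: ler_sum => i _; rewrite RintegralZl//.
    exact: integrable_laplaceK.
  by rewrite -mulr_sumr ler_wpM2l// sum_half_le.
have bound k x A B : `|A| <= nc (d k) -> `|B| <= nc (d k) ->
    `|laplaceK (al * k%:R) sg tau A B x| <= G k x.
  move=> hA hB; apply: (le_trans (normr_laplaceK _ _ _ _ _ _)).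
  rewrite GE ler_wpM2r ?mulr_ge0 ?powR_ge0 ?expR_ge0//; lra.
have [iRe cRe] := @Rintegral_series_dominated R FRe G (fun x => complex.Re (f x)) (Cd * 2)
  (fun k => measurable_laplaceK _ _ _ _ _ (measurable_itv _)) G0 iG
  (fun k x _ => bound k x _ _ (normr_Re_le _) (normr_Im_le _)) SG
  (fun x Dx => (fRI x Dx).1).
have nIm k : `|- complex.Re (d k)| <= nc (d k) by rewrite normrN; exact: normr_Re_le.
have [iIm cIm] := @Rintegral_series_dominated R FIm G (fun x => complex.Im (f x)) (Cd * 2)
  (fun k => measurable_laplaceK _ _ _ _ _ (measurable_itv _)) G0 iG
  (fun k x _ => bound k x _ _ (normr_Im_le _) (nIm k)) SG
  (fun x Dx => (fRI x Dx).2).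
split; [|split; [exact: iRe|exact: iIm]|exact: gS|].
  by move=> z; have [C hC] := Wterm_bound nu hn halpha z; have [] := csum_geometric hC.
have [hRe hIm] := csum_geometricM s^-1 hCg.
apply/eqP; rewrite eq_complex; apply/andP; split; apply/eqP; rewrite /cintegral.
- apply: (cvg_unique _ cRe) => //; move: hRe; apply: cvg_trans.
  apply: near_eq_cvg; apply: nearW => k; rewrite /series/=.
  by apply: eq_bigr => i _; rewrite -E.
- apply: (cvg_unique _ cIm) => //; move: hIm; apply: cvg_trans.
  apply: near_eq_cvg; apply: nearW => k; rewrite /series/=.
  by apply: eq_bigr => i _; rewrite -E.
Qed.
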